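(* Let $k$ be an algebraically closed field, $\mathbf{P}^2=\mathbf{P}^2_k$, and let $C\subset\mathbf{P}^2$ be a reduced curve of degree $d$. Assume that either the characteristic of $k$ is $0$, or it is positive and does not divide $d$. Assume $C$ is a leaf of a foliation $\eta$ of $\mathbf{P}^2$ of degree $m$, and let $S$ be the singular locus of $\eta$. Let $\Sigma$ be the singular locus of $C$, and set $\sigma:=\operatorname{reg}(\Sigma)$ and $\rho:=\sigma-d+2$. Then $$d\le\begin{cases}m+1, &\text{if }\rho\le0;\\ m+1+\rho, &\text{if }\rho>0.\end{cases}$$ Furthermore, if $S$ is finite and $d\ge 2m+2$, then $d=m+1+\rho$.
   Context: A curve in $\mathbf{P}^2$ means a nonzero effective divisor. A (singular) foliation of $\mathbf{P}^2$ is a nonzero map $\eta:\Omega^1_{\mathbf{P}^2}\to\mathcal{L}$ of $\mathcal{O}_{\mathbf{P}^2}$-modules with $\mathcal{L}$ an invertible sheaf. Its singular locus is the closed subscheme $S\subset\mathbf{P}^2$ whose ideal sheaf is $\mathcal{I}_{S,\mathbf{P}^2}:=\operatorname{Im}(\eta\otimes\mathcal{L}^{-1}:\Omega^1_{\mathbf{P}^2}\otimes\mathcal{L}^{-1}\to\mathcal{O}_{\mathbf{P}^2})$; it is not assumed finite. The degree of $\eta$ is $m:=\deg\mathcal{L}+1$, so that $\mathcal{L}\cong\mathcal{O}_{\mathbf{P}^2}(m-1)$; one always has $m\ge0$. (Equivalently, $m$ is the degree of the degeneracy locus on a general line $M$ of the map $(\eta|M,\beta_M):\Omega^1_{\mathbf{P}^2}|M\to\mathcal{L}|M\oplus\Omega^1_M$,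 with $\beta_M$ the natural map.) A reduced curve $C\subset\mathbf{P}^2$ is a leaf of $\eta$ if no irreducible component of $C$ is contained in $S$ and the restriction $\eta|C:\Omega^1_{\mathbf{P}^2}|C\to\mathcal{L}|C$ factors through the natural surjection $\beta_C:\Omega^1_{\mathbf{P}^2}|C\to\Omega^1_C$. ($C$ need not be irreducible.) The singular locus of a reduced curve $C\subset\mathbf{P}^2$ is the closed subscheme $\Sigma\subset C$ whose ideal is the first Fitting ideal of $\Omega^1_C$; at a point where $C$ has local equation $f(x,y)=0$ in local coordinates $x,y$, its ideal in $\mathcal{O}_{\mathbf{P}^2}$ is generated by $f,f_x,f_y$. It is finite. For a finite closed subscheme $T\subset\mathbf{P}^2$, $\operatorname{reg}(T)$ denotes the Castelnuovo--Mumford regularity of its ideal sheaf: the least integer $r$ such that $H^q(\mathbf{P}^2,\mathcal{I}_{T,\mathbf{P}^2}(r-q))=0$ for all $q\ge1$. *)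

(* Defs.v *)
From mathcomp Require Import all_boot all_order all_algebra.
From mathcomp Require Import fraction mpoly ring.

Set Implicit Arguments.
Unset Strict Implicit.
Unset Printing Implicit Defensive.

Import Order.TTheory GRing.Theory Num.Theory.
Local Open Scope ring_scope.

(** Quasi-coherent sheaves on P^2 = Proj K[x_0, x_1, x_2] are given by their
    sections over the standard affine opens U_i = D_+(x_i) and the intersections
    of these.  A nonempty set s of indices stands for U_s, the intersection of
    the U_i for i in s, i.e. the affine open D_+(prod_(i in s) x_i).

    All the sheaves used here are subsheaves of constant sheaves (or quotients
    of one such subsheaf by another), with value K(x_0, x_1, x_2) or the module
    of differentials of that field over K, so that the restriction from U_s to
    U_t, for s \subset t, is an inclusion.  A subsheaf is then a predicate
    depending on s. *)

Notation Poly K := {mpoly K[3]}.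
Notation Frac K := {fraction {mpoly K[3]}}.

(** Differentials of K(x_0, x_1, x_2) over K, with basis dx_0, dx_1, dx_2. *)
Notation Diff K := 'rV[{fraction {mpoly K[3]}}]_3.

Section Plane.
Context {K : fieldType}.

Definition frac_of (p : Poly K) : Frac K := FracField.tofrac p.
Definition var (i : 'I_3) : Frac K := frac_of 'X_i.

(** Submodule generated by G over the ring of coefficients A. *)
Definition span (V : lmodType (Frac K)) (A : Frac K -> Prop) (G : V -> Prop)
    (v : V) : Prop :=
  exists (n : nat) (a : 'I_n -> Frac K) (g : 'I_n -> V),
    (forall i, A (a i) /\ G (g i)) /\ v = \sum_(i < n) a i *: g i.

(** Sections over U_s of O(n). *)
Definition Osec (n : int) (s : {set 'I_3}) (g : Frac K) : Prop :=
  exists (a : Poly K) (k e : nat),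
    [/\ a \is k.-homog, k%:Z = n + (e * #|s|)%:Z
      & g = frac_of a / (\prod_(i in s) var i) ^+ e].

Definition ideal_gen (s : {set 'I_3}) (G : Frac K -> Prop) : Frac K -> Prop :=
  @span (Frac K)^o (Osec 0 s) G.

(** The product I.O(n), i.e. the twist I(n) when I is an ideal sheaf. *)
Definition twist (I : {set 'I_3} -> Frac K -> Prop) (n : int) (s : {set 'I_3}) :
    Frac K -> Prop :=
  ideal_gen s (fun h => exists a b, [/\ I s a, Osec n s b & h = a * b]).

Definition partial (i : 'I_3) (g : Frac K) : Frac K :=
  let: r := repr g in
  frac_of (mderiv i \n_r * \d_r - \n_r * mderiv i \d_r) / frac_of \d_r ^+ 2.

Lemma frac_of_eq0 (p : Poly K) : (frac_of p == 0) = (p == 0).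
Proof. exact: tofrac_eq0. Qed.

Lemma frac_repr (g : Frac K) :
  let: r := repr g in g = frac_of \n_r / frac_of \d_r.
Proof.
set r := repr g; have dr0 : \d_r != 0 by exact: denom_ratioP.
have dF0 : frac_of \d_r != 0 by rewrite frac_of_eq0.
apply: (canRL (mulfK dF0)).
rewrite -[g]reprK -/r /frac_of; unlock FracField.tofrac.
rewrite -[LHS]FracField.pi_mul; apply/eqP.
rewrite FracField.equivf_def /FracField.mulf.
by rewrite !numden_Ratio ?mulr1 ?oner_neq0 // mulrC.
Qed.

Lemma partial_div i (a b : Poly K) : b != 0 ->
  partial i (frac_of a / frac_of b)
  = frac_of (mderiv i a * b - a * mderiv i b) / frac_of b ^+ 2.
Proof.
move=> b0; rewrite /partial; have := frac_repr (frac_of a / frac_of b).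
set r := repr _; have dr0 : \d_r != 0 by exact: denom_ratioP.
move: \n_r \d_r dr0 => n e e0 /eqP.
rewrite eqr_div ?frac_of_eq0 // /frac_of -!tofracM tofrac_eq => /eqP anE.
have /(congr1 (mderiv i)) := anE; rewrite !mderivM => danE.
apply/eqP; rewrite eqr_div ?expf_neq0 ?frac_of_eq0 //.
rewrite /frac_of -!tofracXn -!tofracM tofrac_eq; apply/eqP.
have -> : (mderiv i a * b - a * mderiv i b) * e ^+ 2
  = b * e * (mderiv i a * e + a * mderiv i e) - e * mderiv i b * (a * e)
    - a * e * (mderiv i e * b) by ring.
by rewrite danE anE; ring.
Qed.

Definition diff (g : Frac K) : Diff K := \row_(i < 3) partial i g.

(** Omega^1 of P^2 over U_s.  Since K(x_0, x_1, x_2) is purely transcendental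
    over K(P^2), the module of Kaehler differentials of O(U_s) embeds in Diff K,
    and it is generated over O(U_s) by the differentials of functions. *)
Definition Omega (s : {set 'I_3}) : Diff K -> Prop :=
  span (Osec 0 s) (fun w => exists2 g, Osec 0 s g & w = diff g).

(** A foliation of degree m: a nonzero map eta from Omega^1 to O(m - 1).  Since
    restrictions are inclusions, the maps over the various U_s form a map of
    sheaves exactly when they are restrictions of one function on Diff K, whose
    values outside the modules Omega s are irrelevant. *)
Definition is_foliation (m : int) (eta : Diff K -> Frac K) : Prop :=
  [/\ forall s w, s != set0 -> Omega s w -> Osec (m - 1) s (eta w),
      forall s a w w', s != set0 -> Osec 0 s a -> Omega s w -> Omega s w' ->
        eta (a *: w + w') = a * eta w + eta w'
    & exists s w, [/\ s != set0, Omega s w & eta w != 0]].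

(** Ideal of the singular locus of eta: the image of Omega^1(1 - m) in O. *)
Definition fol_sing_ideal (m : int) (eta : Diff K -> Frac K) (s : {set 'I_3}) :
    Frac K -> Prop :=
  ideal_gen s
    (fun h => exists l w, [/\ Osec (1 - m) s l, Omega s w & h = l * eta w]).

(** Nonzero effective divisor of degree d, with equation f = 0. *)
Definition is_curve (d : nat) (f : Poly K) : Prop :=
  [/\ (0 < d)%N, f != 0 & f \is d.-homog].

(** Ideal of that divisor: f.O(-d). *)
Definition curve_ideal (d : nat) (f : Poly K) (s : {set 'I_3}) (g : Frac K) :
    Prop :=
  exists2 h, Osec (- d%:Z) s h & g = frac_of f * h.

Definition is_reduced (I : {set 'I_3} -> Frac K -> Prop) : Prop :=
  forall s g n, s != set0 -> Osec 0 s g -> I s (g ^+ n) -> I s g.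

Definition is_reduced_curve (d : nat) (f : Poly K) : Prop :=
  is_curve d f /\ is_reduced (curve_ideal d f).

(** p = 0 is an irreducible component, of degree e, of f = 0. *)
Definition is_component (e : nat) (p f : Poly K) : Prop :=
  [/\ is_curve e p,
      forall a b, p = a * b -> a \is a GRing.unit \/ b \is a GRing.unit
    & exists q, f = q * p].

(** Inclusion in the subscheme of ideal I of the subscheme of ideal J. *)
Definition subscheme (J I : {set 'I_3} -> Frac K -> Prop) : Prop :=
  forall s g, s != set0 -> I s g -> J s g.

(** Kernel of Omega^1 -> Omega^1_C over U_s, where C is the subscheme of
    ideal I: the module of differentials of O(U_s)/I(U_s) is the quotient of
    Omega(U_s) by I(U_s).Omega(U_s) and the differentials of elements of
    I(U_s). *)
Definition ker_to_Omega_C (I : {set 'I_3} -> Frac K -> Prop) (s : {set 'I_3}) :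
    Diff K -> Prop :=
  span (Osec 0 s) (fun w =>
    (exists a v, [/\ I s a, Omega s v & w = a *: v]) \/
    (exists2 a, I s a & w = diff a)).

(** eta|C : Omega^1|C -> O(m - 1)|C factors through the surjection
    Omega^1|C -> Omega^1_C: eta maps the kernel of Omega^1 -> Omega^1_C into
    I.O(m - 1), the kernel of O(m - 1) -> O(m - 1)|C. *)
Definition factors_through_Omega_C (m : int) (eta : Diff K -> Frac K)
    (I : {set 'I_3} -> Frac K -> Prop) : Prop :=
  forall s w, s != set0 -> ker_to_Omega_C I s w -> twist I (m - 1) s (eta w).

Definition is_leaf (m : int) (eta : Diff K -> Frac K) (d : nat) (f : Poly K) :
    Prop :=
  [/\ is_reduced_curve d f,
      forall e p, is_component e p f ->
        ~ subscheme (curve_ideal e p) (fol_sing_ideal m eta)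
    & factors_through_Omega_C m eta (curve_ideal d f)].

(** Ideal of the singular locus of the curve f = 0.  On U_i the affine
    coordinates are u_j = x_j / x_i for j != i, the local equation is
    f_i = f / x_i^d, and the derivative with respect to u_j of a homogeneous
    fraction of degree 0 is x_i times its derivative with respect to x_j. *)
Definition curve_sing_ideal (d : nat) (f : Poly K) (s : {set 'I_3}) :
    Frac K -> Prop :=
  ideal_gen s (fun g => exists2 i, i \in s &
    let f_i := frac_of f / var i ^+ d in
    g = f_i \/ exists2 j, j != i & g = var i * partial j f_i).

(** The closed subscheme of ideal I is finite over K. *)
Definition is_finite_subscheme (I : {set 'I_3} -> Frac K -> Prop) : Prop :=
  forall s, s != set0 ->
    exists (n : nat) (b : 'I_n -> Frac K), (forall i, Osec 0 s (b i)) /\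
      forall g, Osec 0 s g ->
        exists c : 'I_n -> K, I s (g - \sum_(i < n) frac_of (c i)%:MP * b i).

(** Cech cohomology for the covering of P^2 by U_0, U_1, U_2.  A q-cochain is
    only considered at the increasing sequences t of q + 1 indices; its other
    values are irrelevant. *)
Definition increasing (q : nat) (t : {ffun 'I_q.+1 -> 'I_3}) : Prop :=
  forall i j : 'I_q.+1, (i < j)%N -> (t i < t j)%N.

Definition is_cochain (F : {set 'I_3} -> Frac K -> Prop) (q : nat)
    (c : {ffun 'I_q.+1 -> 'I_3} -> Frac K) : Prop :=
  forall t, increasing t -> F [set t j | j : 'I_q.+1] (c t).

Definition coboundary (q : nat) (c : {ffun 'I_q.+1 -> 'I_3} -> Frac K)
    (t : {ffun 'I_q.+2 -> 'I_3}) : Frac K :=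
  \sum_(j < q.+2) (-1) ^+ j * c [ffun i => t (lift j i)].

(** Vanishing of H^(q + 1). *)
Definition HS_vanishes (F : {set 'I_3} -> Frac K -> Prop) (q : nat) : Prop :=
  forall c : {ffun 'I_q.+2 -> 'I_3} -> Frac K, is_cochain F c ->
    (forall t, increasing t -> coboundary c t = 0) ->
  exists2 b : {ffun 'I_q.+1 -> 'I_3} -> Frac K, is_cochain F b &
    forall t, increasing t -> c t = coboundary b t.

Definition is_regular (I : {set 'I_3} -> Frac K -> Prop) (r : int) : Prop :=
  forall q : nat, HS_vanishes (twist I (r - q.+1%:Z)) q.

(** sigma is the Castelnuovo-Mumford regularity of the ideal sheaf I. *)
Definition is_reg (I : {set 'I_3} -> Frac K -> Prop) (sigma : int) : Prop :=
  is_regular I sigma /\ forall r, is_regular I r -> sigma <= r.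

End Plane.

(* Main.v *)
From HB Require Import structures.
From mathcomp Require Import all_boot all_order all_algebra.
From mathcomp Require Import fraction mpoly ring zify.
Require Import Defs.

Set Implicit Arguments.
Unset Strict Implicit.
Unset Printing Implicit Defensive.

Import Order.TTheory GRing.Theory Num.Theory.
Local Open Scope ring_scope.

(** A foliation of degree m is induced by a homogeneous vector field A of degree
    m, unique up to multiples of the Euler field. The curve f = 0 being a leaf, f
    divides A(f); as d is invertible, A can be changed by a multiple of the Euler
    field so that A(f) = 0 (lemmas [vf_poly], [vf_grad], [eta_vf]). Thus A is a
    nonzero section of E(m), where E is the bundle of syzygies of the partial
    derivatives of f:

      0 -> E -> O^3 -> I_Sigma(d - 1) -> 0,

    of rank 2 and determinant O(1 - d). Pairing with A gives a map
    E(t) -> O(t + m + 1 - d), which sends e to the h such that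
    e x A = h grad f; it is defined because the partial derivatives of f have no
    common factor, the curve being reduced ([dvd_of_partials],
    [Osec_grad_cancel]). For t >= -2, the connecting map identifies
    H^1(I_Sigma(t + d - 1)) with H^2(E(t)).

    Lower bound ([not_cech1]). Suppose that m <= d - 2, and take t = d - 4 - m, so
    that the target of the pairing is O(-3). The syzygy c x grad f is sent to the
    scalar product c.A, and since A is not 0 the pairing is not 0 on H^2. Hence
    H^1(I_Sigma(2d - 5 - m)) is not 0, and by Castelnuovo-Mumford
    ([is_regular_le]) I_Sigma is not r-regular for any r <= 2d - 4 - m. So
    sigma >= 2d - 3 - m, that is rho >= d - 1 - m > 0. This gives both
    inequalities, which are clear if m >= d - 1.

    Upper bound ([finite_regular]). Suppose that S is finite and d >= 2m + 2, and
    take t = d - 3 - m. The zero scheme W of the section A of E(m) lies in S, so it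
    is finite and there is an exact sequence

      0 -> O(t - m) -> E(t) -> I_W(-2) -> 0.

    Here t - m >= -1, so that H^2(O(t - m)) = 0, and H^2(I_W(-2)) = H^2(O(-2)) = 0
    because W is finite ([paired_cech2]). Hence H^1(I_Sigma(2d - 4 - m)) = 0 and
    sigma <= 2d - 3 - m.

    All these groups are computed with Cech cochains, sections of E being vectors
    of rational functions orthogonal to grad f; for O(n), the computation is one on
    Laurent monomials ([Osec_split], [Osec_nosplit], [Osec_H1]). *)

(** * Identities between rational functions *)

Section Identities.
Context {F : fieldType}.
Implicit Types a b c e y z : F.

Fact ratio_partialE a b c y : y != 0 -> (a * y - c * b) / y ^+ 2 = a / y - b * c / y ^+ 2.
Proof. by move=> y0; field. Qed.

Fact diff_decompE a b c y : y != 0 -> y * a * (b * c / y ^+ 2) = b / y * (c * a).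
Proof. by move=> y0; field. Qed.

Fact eta_diffE a b y : y != 0 -> y * a * b = a * (y ^+ 2 * b) / y.
Proof. by move=> y0; field. Qed.

Fact koszulE a b c y z : y != 0 -> z != 0 ->
  y * (z ^+ 2 * ((a / z - b * c / z ^+ 2) / y)) = z * a - b * c.
Proof. by move=> y0 z0; field; rewrite y0 z0. Qed.

Fact const_ratioE a y : y != 0 -> a / y - a * y / y ^+ 2 = 0.
Proof. by move=> y0; field. Qed.

Fact leaf_coefE a b y z : y != 0 -> z != 0 ->
  b * a = y * z * (a / z * b / y).
Proof. by move=> y0 z0; field; rewrite y0 z0. Qed.

Fact vf_coefE a b c e y z u : a * b = c * e - y * z ->
  - (a * (b * u)) + c * (e * u) = z * (y * u).
Proof. by move=> E; rewrite [a * _]mulrA E; ring. Qed.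

Fact eta_vfE a b c e y : y != 0 ->
  a * (y * b - c * e) / y = b * a - e / y * (c * a).
Proof. by move=> y0; field. Qed.

Fact vf_chartE a b c : a != 0 -> b != 0 -> - (b * c) / (a * b) = - a^-1 * c.
Proof. by move=> a0 b0; field; rewrite a0 b0. Qed.

Fact vf_other_chartE a b c y : y != 0 -> a = (c * b - (c * b - y * a)) / y ^+ 1.
Proof. by move=> y0; field. Qed.

Fact div_swapE a b c z : b != 0 -> z != 0 -> a / z = b * c -> a / b = c * z.
Proof. by move=> b0 z0 E; rewrite -[a](divfK z0) E; field. Qed.

Fact euler_inverseE a b c : a != 0 -> b * c = a^-1 * (b * (a * c)).
Proof. by move=> a0; field. Qed.

Fact euler_chartE a c z : a != 0 -> c / z = a^-1 * z^-1 * (a * c).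
Proof. by move=> a0; rewrite mulrACA mulVf // mul1r mulrC. Qed.

Fact euler_termE a b y z : y != 0 -> - (z * (b * a)) = - (b * y ^- 1) * (a * (z * y)).
Proof. by move=> y0; field. Qed.

Fact rescaleE a b y z : y != 0 -> z != 0 -> b * a = a * (z^-1 * y) * (b * z / y).
Proof. by move=> y0 z0; field; rewrite y0 z0. Qed.

Fact mulXVK a y : y != 0 -> y * (y ^- 1 * a) = a.
Proof. by move=> y0; field. Qed.

Fact climbE1 (c01 c02 c12 w01 w02 w12 y z : F) : y != 0 -> z != 0 ->
  c12 - c02 + c01 = 0 -> z ^- 1 * (y ^- 1 * c12) = w12 - w02 + w01 ->
  (z * w12) - (y ^- 1 * c02 + z * w02) + (y ^- 1 * c01 + z * w01) = 0.
Proof.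
move=> y0 z0 E W; have -> : w12 = z ^- 1 * (y ^- 1 * c12) + w02 - w01 by rewrite W; ring.
have -> : c12 = c02 - c01 by rewrite -[c12](subr0) -E; ring.
by field; rewrite y0 z0.
Qed.

Fact climbE2 (c12 w01 w02 w12 y z : F) : y != 0 -> z != 0 ->
  z ^- 1 * (y ^- 1 * c12) = w12 - w02 + w01 ->
  (z ^- 1 * c12 - y * w12) - (- (y * w02)) + (- (y * w01)) = 0.
Proof.
move=> y0 z0 W; have -> : w12 = z ^- 1 * (y ^- 1 * c12) + w02 - w01 by rewrite W; ring.
by field; rewrite y0 z0.
Qed.

Fact climbE3 (c b b' p p' w y z : F) : y != 0 ->
  y ^- 1 * c + z * w = b - b' -> - (y * w) = p - p' ->
  c = (y * b + z * p) - (y * b' + z * p').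
Proof.
move=> y0 E1 E2; have -> : b = y ^- 1 * c + z * w + b' by rewrite E1; ring.
by have -> : p = - (y * w) + p' by [rewrite E2; ring]; field.
Qed.

Fact climbE4 (c b b' p p' w y z : F) : z != 0 ->
  z * w = b - b' -> z ^- 1 * c - y * w = p - p' ->
  c = (y * b + z * p) - (y * b' + z * p').
Proof.
move=> z0 E1 E2; have -> : b = z * w + b' by rewrite E1; ring.
by have -> : p = z ^- 1 * c - y * w + p' by [rewrite E2; ring]; field.
Qed.

Fact unit_partE a b y z : z != 0 -> (b * y + z) * a = a * (z * (1 - y * (- z^-1 * b))).
Proof. by move=> z0; field. Qed.

Fact inverse_varE a c z : c != 0 -> a != 0 -> c^-1 * (a^-1 * (a * (c * z))) = z.
Proof. by move=> c0 a0; field; rewrite c0 a0. Qed.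

End Identities.

(** * Sections of O(n) over the U_s *)

Section TwistedSections.
Context {K : fieldType}.
Implicit Types (a b : Poly K) (g h : Frac K) (s t : {set 'I_3}) (n : int).
Implicit Types (u v : 'X_{1..3}).

Fact frac_of_is_zmod_morphism : zmod_morphism (@frac_of K).
Proof. exact: tofracB. Qed.
Fact frac_of_is_monoid_morphism : monoid_morphism (@frac_of K).
Proof. by split; [exact: tofrac1 | exact: tofracM]. Qed.
HB.instance Definition _ := GRing.isZmodMorphism.Build (Poly K) (Frac K)
  (@frac_of K) frac_of_is_zmod_morphism.
HB.instance Definition _ := GRing.isMonoidMorphism.Build (Poly K) (Frac K)
  (@frac_of K) frac_of_is_monoid_morphism.

Lemma frac_ofM : {morph @frac_of K : a b / a * b}. Proof. exact: rmorphM. Qed.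
Lemma frac_ofB : {morph @frac_of K : a b / a - b}. Proof. exact: rmorphB. Qed.
Lemma frac_ofXn e : {morph @frac_of K : a / a ^+ e}. Proof. exact: rmorphXn. Qed.
Lemma frac_of0 : frac_of 0 = 0 :> Frac K. Proof. exact: rmorph0. Qed.
Lemma frac_of1 : frac_of 1 = 1 :> Frac K. Proof. exact: rmorph1. Qed.

Lemma frac_of_inj : injective (@frac_of K).
Proof. by move=> a b /eqP; rewrite tofrac_eq => /eqP. Qed.

Lemma frac_of_neq0 a : (frac_of a != 0) = (a != 0).
Proof. by rewrite frac_of_eq0. Qed.

Lemma mpolyX_neq0 (u : 'X_{1..3}) : 'X_[u] != 0 :> Poly K.
Proof.
apply/eqP=> /(congr1 (mcoeff u)); rewrite mcoeffX eqxx mcoeff0 => /eqP.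
by rewrite oner_eq0.
Qed.

Definition fmon (u : 'X_{1..3}) : Frac K := frac_of 'X_[u].

Lemma fmon_neq0 u : fmon u != 0.
Proof. by rewrite frac_of_neq0 mpolyX_neq0. Qed.

Lemma fmonD u v : fmon (u + v) = fmon u * fmon v.
Proof. by rewrite /fmon mpolyXD rmorphM. Qed.

Lemma fmonMn u e : fmon (u *+ e) = fmon u ^+ e.
Proof. by rewrite /fmon -mpolyXn rmorphXn. Qed.

Lemma fmon0 : fmon 0 = 1.
Proof. by rewrite /fmon mpolyX0 rmorph1. Qed.

Local Notation x := (@var K).

Lemma fmon1 i : fmon U_(i) = x i. Proof. by []. Qed.

Lemma var_neq0 i : var i != 0 :> Frac K.
Proof. exact: (fmon_neq0 U_(i)). Qed.

(** Exponent of the product of the variables in s, the denominator in [Osec]. *)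
Definition ind (s : {set 'I_3}) : 'X_{1..3} := [multinom (i \in s : nat) | i < 3].

Lemma mdeg_ind s : mdeg (ind s) = #|s|.
Proof.
rewrite mdegE -sum1_card [RHS]big_mkcond /=.
by apply: eq_bigr => i _; rewrite mnmE; case: (i \in s).
Qed.

Lemma fmon_ind s : fmon (ind s) = \prod_(i in s) var i.
Proof.
rewrite /fmon mpolyXE_id rmorph_prod [RHS]big_mkcond /=.
by apply: eq_bigr => i _; rewrite mnmE; case: (i \in s); rewrite ?expr1 // expr0 rmorph1.
Qed.

Lemma OsecP n s g :
  Osec n s g <-> exists a k e, [/\ a \is k.-homog, k%:Z = n + (e * #|s|)%:Z
      & g = frac_of a / fmon (ind s *+ e)].
Proof.
by split=> -[a [k [e [ah ke ->]]]]; exists a, k, e; split=> //;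
  rewrite fmonMn fmon_ind.
Qed.

(** Powers of the single denominator of [Osec] are inconvenient for products and
    inverses of variables; any monomial supported on s can be used instead. *)
Lemma Osec_frac n s a k (u : 'X_{1..3}) :
  a \is k.-homog -> (forall i, i \notin s -> u i = 0%N) ->
  k%:Z = n + (mdeg u)%:Z -> Osec n s (frac_of a / fmon u).
Proof.
move=> ah us ku; apply/OsecP.
pose v := [multinom (if i \in s then mdeg u - u i else 0)%N | i < 3].
have uv : (ind s *+ mdeg u = u + v)%MM.
  apply/mnmP=> i; rewrite mulmnE mnmDE !mnmE; case: ifP => [_|/negbT/us ->].
    rewrite mul1n subnKC // mdegE (bigD1 i) //=; lia.
  by rewrite mul0n.
exists ('X_[v] * a), (mdeg v + k)%N, (mdeg u); split.
- by apply: dhomogM => //; rewrite dhomogX.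
- have := congr1 mdeg uv; rewrite mdegMn mdeg_ind mdegD; lia.
- by rewrite uv fmonD rmorphM [frac_of _ * frac_of a]mulrC -mulf_div mulfV ?fmon_neq0 // mulr1.
Qed.

(** Multiplying numerator and denominator by a monomial raises e; this is how
    several sections are put over the same denominator. *)
Lemma Osec_den n s g : Osec n s g -> exists e0, forall e, (e0 <= e)%N ->
  exists a k, [/\ a \is k.-homog, k%:Z = n + (e * #|s|)%:Z
    & g = frac_of a / fmon (ind s *+ e)].
Proof.
case/OsecP=> a [k [e0 [ah ke ->]]]; exists e0 => e le.
exists ('X_[ind s *+ (e - e0)] * a), (mdeg (ind s *+ (e - e0))%MM + k)%N; split.
- by apply: dhomogM => //; rewrite dhomogX.
- by rewrite PoszD ke mdegMn mdeg_ind; nia.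
- have -> : (ind s *+ e = ind s *+ e0 + ind s *+ (e - e0))%MM.
    by apply/mnmP=> i; rewrite mnmDE !mulmnE -mulnDr subnKC.
  by rewrite fmonD rmorphM [frac_of _ * frac_of a]mulrC -mulf_div mulfV ?fmon_neq0 // mulr1.
Qed.

Lemma ind_notin s e i : i \notin s -> (ind s *+ e)%MM i = 0%N.
Proof. by rewrite mulmnE mnmE => /negbTE->. Qed.

Lemma Osec_add n s g h : Osec n s g -> Osec n s h -> Osec n s (g + h).
Proof.
case/Osec_den=> e1 H1 /Osec_den[e2 H2].
have [a [k [ah ke ->]]] := H1 (maxn e1 e2) (leq_maxl _ _).
have [b [l [bh le ->]]] := H2 (maxn e1 e2) (leq_maxr _ _).
have kl : k = l by lia.
rewrite -mulrDl -rmorphD; apply: (@Osec_frac n s _ k).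
- by rewrite dhomogD // kl.
- exact: ind_notin.
- by rewrite mdegMn mdeg_ind; lia.
Qed.

Lemma Osec_scale n s g (c : K) : Osec n s g -> Osec n s (frac_of c%:MP * g).
Proof.
case/OsecP=> a [k [e [ah ke ->]]].
rewrite mulrA -rmorphM mul_mpolyC; apply: (Osec_frac (k := k)).
- exact: dhomogZ.
- exact: ind_notin.
- by rewrite mdegMn mdeg_ind; lia.
Qed.

Lemma Osec_opp n s g : Osec n s g -> Osec n s (- g).
Proof. by move/(Osec_scale (-1)); rewrite mpolyCN rmorphN rmorph1 mulN1r. Qed.

Lemma Osec_sub n s g h : Osec n s g -> Osec n s h -> Osec n s (g - h).
Proof. by move=> Hg /Osec_opp; apply: Osec_add. Qed.

Lemma Osec_mul n n' s g h : Osec n s g -> Osec n' s h -> Osec (n + n') s (g * h).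
Proof.
case/OsecP=> a [k [e [ah ke ->]]] /OsecP[b [l [e' [bh le ->]]]].
rewrite mulf_div -rmorphM -fmonD; apply: (Osec_frac (k := k + l)%N).
- exact: dhomogM.
- by move=> i si; rewrite mnmDE !ind_notin.
- by rewrite mdegD !mdegMn mdeg_ind; lia.
Qed.

Lemma Osec_mono n s t g : s \subset t -> Osec n s g -> Osec n t g.
Proof.
move=> st /OsecP[a [k [e [ah ke ->]]]]; apply: (Osec_frac (k := k)) => //.
- by move=> i /(contra (subsetP st i))/ind_notin.
- by rewrite mdegMn mdeg_ind; lia.
Qed.

Lemma Osec_poly n s a k : a \is k.-homog -> k%:Z = n -> Osec n s (frac_of a).
Proof.
move=> ah kn; rewrite -[frac_of a]divr1 -fmon0; apply: (Osec_frac (k := k)) => //.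
- by move=> i _; rewrite mnm0E.
- by rewrite mdeg0; lia.
Qed.

Lemma homogX u : ('X_[u] : Poly K) \is (mdeg u).-homog.
Proof. by rewrite dhomogX. Qed.

Lemma Osec_fmon s u : Osec (mdeg u)%:Z s (fmon u).
Proof. exact: (Osec_poly _ (homogX u)). Qed.

Lemma Osec_fmonV s u : (forall i, i \notin s -> u i = 0%N) ->
  Osec (- (mdeg u)%:Z) s (fmon u)^-1.
Proof.
move=> us; rewrite -div1r -frac_of1.
by apply: (Osec_frac (k := 0)) => //; [exact: dhomog1 | lia].
Qed.

Lemma Osec_var s i : Osec 1 s (x i).
Proof. by have := Osec_fmon s U_(i); rewrite mdeg1. Qed.

Lemma Osec_varX s i e : Osec e%:Z s (x i ^+ e).
Proof. by have := Osec_fmon s (U_(i) *+ e); rewrite mdegMn mdeg1 fmonMn mul1n. Qed.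

Lemma Osec_varV s i e : i \in s -> Osec (- e%:Z) s (x i ^- e).
Proof.
move=> si; have := @Osec_fmonV s (U_(i) *+ e)%MM.
rewrite mdegMn mdeg1 fmonMn mul1n; apply => j js.
by rewrite mulmnE mnm1E; case: eqP => [ij|//]; rewrite -ij si in js.
Qed.

Lemma Osec1 s : Osec 0 s (1 : Frac K).
Proof. by rewrite -frac_of1; apply: Osec_poly => //; exact: dhomog1. Qed.

Lemma Osec0 n s : s != set0 -> Osec n s (0 : Frac K).
Proof.
case/set0Pn=> i si; rewrite -frac_of0 -[frac_of 0]divr1.
case: n => [k|k].
  by rewrite divr1; apply: (@Osec_poly _ _ _ k) => //; exact: dhomog0.
have -> : frac_of 0 / 1 = frac_of 0 / fmon (U_(i) *+ k.+1) by rewrite frac_of0 !mul0r.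
apply: (Osec_frac (k := 0)); first exact: dhomog0.
  move=> j js; rewrite mulmnE mnm1E.
  by case: eqP => [ij|//]; rewrite -ij si in js.
by rewrite mdegMn mdeg1; lia.
Qed.

Lemma Osec_sum n s (I : Type) (r : seq I) (P : pred I) (F : I -> Frac K) :
  s != set0 -> (forall i, P i -> Osec n s (F i)) -> Osec n s (\sum_(i <- r | P i) F i).
Proof.
by move=> s0 H; elim/big_rec: _ => [|i x Pi]; [exact: Osec0 | exact/Osec_add/H].
Qed.

End TwistedSections.

(** * Laurent monomials and the cohomology of O(n) *)

Definition o0 : 'I_3 := @Ordinal 3 0 isT.
Definition o1 : 'I_3 := @Ordinal 3 1 isT.
Definition o2 : 'I_3 := @Ordinal 3 2 isT.

Lemma all3 (P : 'I_3 -> Prop) : P o0 -> P o1 -> P o2 -> forall i, P i.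
Proof.
move=> P0 P1 P2 [[|[|[|//]]] lt_i].
- by rewrite (_ : Ordinal _ = o0) //; apply: val_inj.
- by rewrite (_ : Ordinal _ = o1) //; apply: val_inj.
- by rewrite (_ : Ordinal _ = o2) //; apply: val_inj.
Qed.

Lemma sum3 (V : nmodType) (F : 'I_3 -> V) : \sum_i F i = F o0 + F o1 + F o2.
Proof.
rewrite !big_ord_recl big_ord0 addr0 addrA.
by congr (F _ + F _ + F _); apply: val_inj.
Qed.

Section Laurent.
Context {K : fieldType}.
Implicit Types (a b : Poly K) (g h : Frac K) (s t : {set 'I_3}) (n : int).
Implicit Types (u v : 'X_{1..3}).
Local Notation x := (@var K).

(** The homogeneous component of b of degree k - j already gives c, so it is b. *)
Lemma homog_quotient a b c j k : a \is j.-homog -> a != 0 -> a * b = c ->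
  c \is k.-homog -> c != 0 -> exists2 l, k = (j + l)%N & b \is l.-homog.
Proof.
move=> ah a0 abc ch c0.
have [l lt_l] : exists l, (mmeasure mdeg b <= l)%N by exists (mmeasure mdeg b).
have E := pihomog_partitionE lt_l.
have Ek : c = \sum_(e < l | (j + e == k)%N) a * pihomog mdeg e b.
  rewrite -(pihomog_dE ch) -abc {1}E mulr_sumr raddf_sum /= [RHS]big_mkcond.
  apply: eq_bigr => e _; have H : a * pihomog mdeg e b \is (j + e).-homog.
    by apply: dhomogM => //; apply: pihomogP.
  by case: eqP => [<-|/eqP ne]; [rewrite pihomog_dE | rewrite (pihomog_ne0 ne H)].
have lejk : (j <= k)%N.
  rewrite leqNgt; apply/negP=> lt; case/eqP: c0; rewrite Ek big_pred0 // => e.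
  by apply/negbTE/eqP; lia.
exists (k - j)%N; first by rewrite subnKC.
have [lt|le] := ltnP (k - j)%N l; last first.
  case/eqP: c0; rewrite Ek big_pred0 // => e; apply/negbTE/eqP.
  by have := ltn_ord e; lia.
have := Ek; rewrite (bigD1 (Ordinal lt)) /= ?subnKC // big_pred0 ?addr0; last first.
  move=> e; apply/negbTE; rewrite negb_and negbK -val_eqE /=.
  by case: (_ =P _) => // <-; rewrite addKn eqxx.
by rewrite -abc => /(mulfI a0) ->; apply: pihomogP.
Qed.

Lemma homog_mdeg a k m : a \is k.-homog -> m \in msupp a -> mdeg m = k.
Proof. by move=> /dhomog_mf H /H. Qed.

Lemma divX a k u : a \is k.-homog -> (forall m, m \in msupp a -> (u <= m)%MM) ->
  exists2 a', a = 'X_[u] * a' & forall l, (k = l + mdeg u)%N -> a' \is l.-homog.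
Proof.
move=> /dhomogP ah H; exists (\sum_(m <- msupp a) a@_m *: 'X_[m - u]).
  rewrite mulr_sumr {1}[a]mpolyE !big_seq; apply: eq_bigr => m /H um.
  by rewrite -scalerAr -mpolyXD addmC submK.
move=> l kl; rewrite big_seq; apply: rpred_sum => m ma; apply: dhomogZ.
rewrite dhomogX; apply/eqP; have := congr1 mdeg (submK (H m ma)).
by rewrite mdegD [RHS](ah _ ma) kl => /addIn.
Qed.

Lemma msupp_mulX a u m : (m + u)%MM \in msupp (a * 'X_[u]) = (m \in msupp a).
Proof. by rewrite !mcoeff_msupp addmC mcoeffMX. Qed.

Lemma msupp_mulX_ge a u m : m \in msupp (a * 'X_[u]) -> (u <= m)%MM.
Proof.
rewrite (perm_mem (msuppMX _ _)) => /mapP[m' _ ->].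
exact: lem_addr.
Qed.

Lemma fmon_cross a b u v : frac_of a / fmon u = frac_of b / fmon v ->
  a * 'X_[v] = b * 'X_[u].
Proof.
move/eqP; rewrite eqr_div ?fmon_neq0 // -!rmorphM => /eqP.
exact: frac_of_inj.
Qed.

(** A monomial of the numerator over U_s cancels the variables which are not
    inverted on U_t. The alternative g = 0 is needed when s and t are disjoint and
    n < 0: [Osec] has no section at all over the empty set, not even 0. *)
Lemma Osec_inter n s t g : Osec n s g -> Osec n t g ->
  g = 0 \/ Osec n (s :&: t) g.
Proof.
case/Osec_den=> e1 H1 /Osec_den[e2 H2].
have [a [k [ah ke E1]]] := H1 (maxn e1 e2) (leq_maxl _ _).
have [b [l [bh le]]] := H2 (maxn e1 e2) (leq_maxr _ _).
rewrite E1; move: (maxn _ _) ke le => e ke le /fmon_cross E.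
have [->|a0] := eqVneq a 0; [by left; rewrite frac_of0 mul0r | right].
have Hm m : m \in msupp a -> (ind (s :\: t) *+ e <= m)%MM.
  rewrite -(msupp_mulX _ (ind t *+ e)) E => /msupp_mulX_ge/mnm_lepP H.
  apply/mnm_lepP=> i; move: (H i); rewrite mnmDE !mulmnE !mnmE !inE.
  by case: (i \in s); case: (i \in t); rewrite //= !mul0n addn0.
have [a' Ea Ha'] := divX ah Hm.
have uE : (ind s *+ e = ind (s :\: t) *+ e + ind (s :&: t) *+ e)%MM.
  apply/mnmP=> i; rewrite mnmDE !mulmnE !mnmE !inE.
  by case: (i \in s); case: (i \in t); lia.
rewrite Ea uE fmonD rmorphM -mulf_div mulfV ?fmon_neq0 // mul1r.
have [m ma] : exists m, m \in msupp a.
  by move: a0; rewrite -msupp_eq0; case: (msupp a) => // m r _; exists m; rewrite mem_head.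
have km : (k = (k - mdeg (ind (s :\: t) *+ e)%MM) + mdeg (ind (s :\: t) *+ e)%MM)%N.
  rewrite subnK // -(homog_mdeg ah ma) -[in leqRHS](submK (Hm _ ma)) mdegD.
  exact: leq_addl.
apply: (Osec_frac (Ha' _ km)); first exact: ind_notin.
have := congr1 mdeg uE; rewrite mdegD !mdegMn !mdeg_ind in km *; nia.
Qed.

Lemma frac_ind (D : Frac K -> Prop) a u : D 0 -> (forall g h, D g -> D h -> D (g + h)) ->
  (forall m c, m \in msupp a -> D (frac_of (c *: 'X_[m]) / fmon u)) -> D (frac_of a / fmon u).
Proof.
move=> D0 DD H; rewrite [a]mpolyE rmorph_sum mulr_suml big_seq.
by elim/big_rec: _ => [|m y ma Dy] //; apply: DD => //; apply: H.
Qed.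

Lemma Osec_clear n s j g : Osec n s g ->
  exists L : nat, Osec (n + L%:Z) (s :\ j) (x j ^+ L * g).
Proof.
case/OsecP=> a [k [e [ah ke ->]]].
have [js|js] := boolP (j \in s); last first.
  exists 0%N; rewrite addr0 expr0 mul1r; have -> : s :\ j = s.
    by apply/setP=> i; rewrite !inE; case: eqP => // ->; rewrite (negbTE js).
  by apply/OsecP; exists a, k, e.
exists e; apply/OsecP; exists a, k, e.
have E : ind s = (U_(j) + ind (s :\ j))%MM.
  apply/mnmP=> i; rewrite mnmDE mnm1E !mnmE !inE eq_sym.
  by case: eqP => // ->; rewrite js.
split=> //; first by have := cardsD1 j s; rewrite js; nia.
by rewrite !fmonMn E fmonD exprMn fmon1 invfM mulrCA mulVKf ?expf_neq0 ?var_neq0.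
Qed.

(** H^2(P^2, O(n)) = 0: a Laurent monomial of degree at least -2 in three
    variables has a nonnegative exponent. *)
Lemma Osec_split n g : -2 <= n -> Osec n setT g ->
  exists2 h : 'I_3 -> Frac K, forall l, Osec n [set~ l] (h l) & g = \sum_l h l.
Proof.
move=> n2 /OsecP[a [k [e [ah ke ->]]]].
pose D g := exists2 h : 'I_3 -> Frac K, forall l, Osec n [set~ l] (h l) & g = \sum_l h l.
have nz l : [set~ l] != set0 :> {set 'I_3}.
  by rewrite -card_gt0 cardsC1 card_ord.
apply: (frac_ind (D := D)).
- by exists (fun _ => 0) => [l|]; [exact: Osec0 | rewrite big1].
- move=> _ _ [h1 H1 ->] [h2 H2 ->]; exists (fun l => h1 l + h2 l).
    by move=> l; apply: Osec_add.
  by rewrite big_split.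
move=> m c ma.
have [l le] : exists l, (e <= m l)%N.
  apply/existsP; rewrite -[[exists _, _]]negbK; apply/negP=> /existsPn H.
  have := homog_mdeg ah ma; rewrite mdegE sum3.
  by move: (H o0) (H o1) (H o2) ke; rewrite cardsT card_ord; lia.
have um : (U_(l) *+ e <= m)%MM.
  by apply/mnm_lepP=> i; rewrite mulmnE mnm1E; case: eqP => [<-|]; rewrite ?mul1n ?mul0n.
exists (fun i => if i == l
    then frac_of (c *: 'X_[m - U_(l) *+ e]) / fmon (ind [set~ l] *+ e) else 0).
  move=> i; case: eqP => [->|_]; last exact: Osec0.
  apply: (Osec_frac (k := mdeg (m - U_(l) *+ e)%MM)).
  - by apply: dhomogZ; exact: homogX.
  - exact: ind_notin.
  have := congr1 mdeg (submK um); rewrite mdegD !mdegMn mdeg1 mdeg_ind.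
  by rewrite (homog_mdeg ah ma) cardsC1 card_ord; rewrite cardsT card_ord in ke; lia.
rewrite -big_mkcond big_pred1_eq -{1}(submK um) mpolyXD scalerAl rmorphM.
have -> : (ind setT *+ e = ind [set~ l] *+ e + U_(l) *+ e)%MM.
  apply/mnmP=> i; rewrite mnmDE !mulmnE mnm1E !mnmE !inE eq_sym.
  by case: eqP; lia.
by rewrite fmonD -mulf_div mulfV ?fmon_neq0 // mulr1.
Qed.

(** H^2(P^2, O(-3)) is not 0: a class is detected by its coefficient of
    1 / (x_0 x_1 x_2), here that of the monomial m in a. *)
Lemma Osec_nosplit a m (h : 'I_3 -> Frac K) : m \in msupp a ->
  (forall l, Osec (-3) [set~ l] (h l)) ->
  frac_of a / fmon (m + ind setT) <> \sum_l h l.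
Proof.
move=> ma Hh.
have [e [me He]] : exists e, (forall i, m i < e)%N /\
    forall l, exists b, h l = frac_of b / fmon (ind [set~ l] *+ e).
  have [e0 H0] := Osec_den (Hh o0); have [e1 H1] := Osec_den (Hh o1).
  have [e2 H2] := Osec_den (Hh o2).
  exists (mdeg m + e0 + e1 + e2).+1; split.
    by move=> i; rewrite mdegE (bigD1 i) //=; lia.
  apply: all3.
  - by have [|b [k [_ _ ->]]] := H0 (mdeg m + e0 + e1 + e2).+1; [lia | exists b].
  - by have [|b [k [_ _ ->]]] := H1 (mdeg m + e0 + e1 + e2).+1; [lia | exists b].
  - by have [|b [k [_ _ ->]]] := H2 (mdeg m + e0 + e1 + e2).+1; [lia | exists b].
pose w : 'X_{1..3} := [multinom e.-1 | i < 3].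
pose r : 'X_{1..3} := [multinom (e.-1 - m i)%N | i < 3].
move/(congr1 ( *%R (fmon (ind setT *+ e)))); rewrite mulr_sumr.
have rE : (ind setT *+ e = (m + ind setT) + r)%MM.
  by apply/mnmP=> i; rewrite !mnmDE mulmnE !mnmE inE; have := me i; lia.
rewrite {1}rE fmonD mulrC mulrA divfK ?fmon_neq0 // -rmorphM.
have Hb l : exists b, fmon (ind setT *+ e) * h l = frac_of (b * 'X_[U_(l) *+ e]).
  have [b ->] := He l; exists b.
  have -> : (ind setT *+ e = ind [set~ l] *+ e + U_(l) *+ e)%MM.
    apply/mnmP=> i; rewrite mnmDE !mulmnE mnm1E !mnmE !inE eq_sym.
    by case: eqP; lia.
  by rewrite fmonD mulrC mulrA divfK ?fmon_neq0 // rmorphM.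
have [[b0 E0] [b1 E1] [b2 E2]] := And3 (Hb o0) (Hb o1) (Hb o2).
rewrite sum3 E0 E1 E2 -!rmorphD => /frac_of_inj/(congr1 (mcoeff (r + m)%MM)).
have z l b : (b * 'X_[U_(l) *+ e])@_(r + m) = 0.
  apply/eqP; rewrite mcoeff_eq0; apply/negP=> /msupp_mulX_ge/mnm_lepP/(_ l).
  by rewrite mulmnE mnm1E eqxx mul1n mnmDE !mnmE; have := me l; lia.
by rewrite !mcoeffD !z !addr0 mcoeffMX => /eqP; rewrite mcoeff_eq0 ma.
Qed.

(** H^1(P^2, O(n)) = 0: a term of b01 with poles along both x_0 = 0 and x_1 = 0
    can occur neither in b02 nor in b12. *)
Lemma Osec_H1 n (b01 b02 b12 : Frac K) :
  Osec n [set o0; o1] b01 -> Osec n [set o0; o2] b02 -> Osec n [set o1; o2] b12 ->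
  b12 - b02 + b01 = 0 ->
  exists c : 'I_3 -> Frac K, [/\ forall i, Osec n [set i] (c i), b01 = c o1 - c o0,
    b02 = c o2 - c o0 & b12 = c o2 - c o1].
Proof.
move=> H01 H02 H12 E.
have [e [a [k [ah ke Ea]]] [[b Eb] [c Ec]]] : exists2 e,
    (exists a k, [/\ a \is k.-homog, k%:Z = n + (e * #|[set o0; o1]|)%:Z &
       b01 = frac_of a / fmon (ind [set o0; o1] *+ e)]) &
    (exists b, b02 = frac_of b / fmon (ind [set o0; o2] *+ e)) /\
    (exists c, b12 = frac_of c / fmon (ind [set o1; o2] *+ e)).
  have [e0 H0] := Osec_den H01; have [e1 H1] := Osec_den H02.
  have [e2 H2] := Osec_den H12; exists (e0 + e1 + e2)%N; first by apply: H0; lia.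
  split.
  - by have [|b [k [_ _ ->]]] := H1 (e0 + e1 + e2)%N; [lia | exists b].
  - by have [|b [k [_ _ ->]]] := H2 (e0 + e1 + e2)%N; [lia | exists b].
have Eabc : a * 'X_[U_(o2) *+ e] = b * 'X_[U_(o1) *+ e] - c * 'X_[U_(o0) *+ e].
  apply: frac_of_inj; rewrite rmorphB !rmorphM.
  have Hd i j l (y : Poly K) g : (forall r : 'I_3, (r == i) + ((r == j) + (r == l)) = 1)%N ->
     g = frac_of y / fmon (ind [set i; j] *+ e) ->
     frac_of y * fmon (U_(l) *+ e) = g * fmon (ind setT *+ e).
    move=> Hr ->; have -> : (ind setT *+ e = ind [set i; j] *+ e + U_(l) *+ e)%MM.
      apply/mnmP=> r; rewrite mnmDE !mulmnE mnm1E !mnmE !inE [l == r]eq_sym.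
      by have := Hr r; do 3!case: eqP => //=; lia.
    by rewrite fmonD mulrA divfK ?fmon_neq0.
  rewrite (Hd o0 o1 o2 a b01) // ?(Hd o0 o2 o1 b b02) // ?(Hd o1 o2 o0 c b12) //;
    try by apply: all3.
  by rewrite -mulrBl; congr (_ * _); rewrite -[LHS](addKr (b12 - b02)) E; ring.
have [c0 [c1 [C0 C1 E01]]] : exists c0 c1, [/\ Osec n [set o0] c0,
    Osec n [set o1] c1 & b01 = c1 - c0].
  rewrite Ea; apply: (frac_ind (D := fun g => exists c0 c1, [/\ Osec n [set o0] c0,
    Osec n [set o1] c1 & g = c1 - c0])).
  - have nz i : [set i] != set0 :> {set 'I_3} by rewrite -card_gt0 cards1.
    by exists 0, 0; split; rewrite ?subr0 //; exact: Osec0.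
  - move=> _ _ [p0 [p1 [P0 P1 ->]]] [q0 [q1 [Q0 Q1 ->]]].
    by exists (p0 + q0), (p1 + q1); split; [exact: Osec_add| exact: Osec_add| ring].
  move=> m z ma.
  have nz i : [set i] != set0 :> {set 'I_3} by rewrite -card_gt0 cards1.
  have term i j : i != j -> [set o0; o1] = [set i; j] -> (e <= m i)%N ->
      Osec n [set j] (frac_of (z *: 'X_[m]) / fmon (ind [set o0; o1] *+ e)).
    move=> ij -> le; have um : (U_(i) *+ e <= m)%MM.
      by apply/mnm_lepP=> r; rewrite mulmnE mnm1E; case: eqP => [<-|]; rewrite ?mul1n ?mul0n.
    have -> : (ind [set i; j] *+ e = ind [set j] *+ e + U_(i) *+ e)%MM.
      apply/mnmP=> r; rewrite mnmDE !mulmnE mnm1E !mnmE !inE [i == r]eq_sym.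
      by have [->|_] := eqVneq r i; rewrite ?(negbTE ij) /=; lia.
    rewrite -(submK um) mpolyXD scalerAl rmorphM fmonD -mulf_div.
    rewrite mulfV ?fmon_neq0 // mulr1; apply: (Osec_frac (k := mdeg (m - U_(i) *+ e)%MM)).
    - by apply: dhomogZ; exact: homogX.
    - exact: ind_notin.
    have := congr1 mdeg (submK um); rewrite mdegD !mdegMn mdeg1 mdeg_ind.
    by rewrite (homog_mdeg ah ma) cards1; rewrite cards2 /= in ke; lia.
  have [le|lt0] := leqP e (m o0).
    exists 0, (frac_of (z *: 'X_[m]) / fmon (ind [set o0; o1] *+ e)).
    by split; [exact: Osec0 | exact: (term o0) | rewrite subr0].
  have [le|lt1] := leqP e (m o1).
    exists (- (frac_of (z *: 'X_[m]) / fmon (ind [set o0; o1] *+ e))), 0.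
    by split; [apply/Osec_opp/(term o1) => //; exact: setUC| exact: Osec0 | rewrite sub0r opprK].
  have := msupp_mulX a (U_(o2) *+ e) m; rewrite ma Eabc => /msuppB_le.
  by rewrite mem_cat => /orP[]/msupp_mulX_ge/mnm_lepP;
    [move/(_ o1) | move/(_ o0)]; rewrite mulmnE mnm1E eqxx mnmDE mulmnE mnm1E /=; lia.
have [c2 [C2a C2b]] : exists c2, Osec n [set o2] c2 /\ c2 = b02 + c0.
  have I : [set o0; o2] :&: [set o1; o2] = [set o2].
    by apply/setP; apply: all3; rewrite !inE.
  have P : Osec n [set o0; o2] (b02 + c0).
    by apply: Osec_add => //; apply: Osec_mono C0; rewrite sub1set !inE.
  have Q : Osec n [set o1; o2] (b02 + c0).
    have -> : b02 + c0 = b12 + c1.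
      by rewrite -[b12](addrK (b01 - b02)) addrA [b12 + b01 - b02]addrAC E E01; ring.
    by apply: Osec_add => //; apply: Osec_mono C1; rewrite sub1set !inE.
  have [z|] := Osec_inter P Q; last by rewrite I; exists (b02 + c0).
  by exists 0; split; [apply: Osec0; rewrite -card_gt0 cards1 | rewrite z].
exists (fun i => if i == o0 then c0 else if i == o1 then c1 else c2); split => //=.
- by apply: all3.
- by rewrite C2b addrK.
- rewrite C2b -[LHS](addrK (b01 - b02)) addrA [b12 + b01 - b02]addrAC E E01; ring.
Qed.

End Laurent.

(** * Linear forms, Euler's relation and p-th powers *)

Section Divisibility.
Context {K : fieldType}.
Implicit Types (a b f : Poly K) (g h : Frac K) (s t : {set 'I_3}) (n : int).
Implicit Types (u v : 'X_{1..3}).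
Local Notation x := (@var K).

Section LinearForm.
Variables (i l : 'I_3) (c : K).
Hypothesis il : i != l.

Definition subst_lin : 3.-tuple (Poly K) :=
  [tuple (if r == i then c *: 'X_l else 'X_r) | r < 3].

(** The substitution is the reduction modulo the linear form x_i - c x_l. *)
Lemma subst_linE a : exists b, a - (a \mPo subst_lin) = ('X_i - c *: 'X_l) * b.
Proof.
elim/mpolyind: a => [|z m p _ _ [b Eb]]; first by exists 0; rewrite comp_mpoly0 subrr mulr0.
suff [y Ey] : exists y, 'X_[m] - ('X_[m] \mPo subst_lin) = ('X_i - c *: 'X_l) * y.
  exists (z *: y + b); rewrite comp_mpolyD comp_mpolyZ mulrDr -Eb -scalerAr -Ey.
  by rewrite scalerBr addrACA opprD.
rewrite comp_mpolyX mpolyXE_id.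
apply: (big_ind2 (fun p q => exists y, p - q = ('X_i - c *: 'X_l) * y)).
- by exists 0; rewrite subrr mulr0.
- move=> p1 q1 p2 q2 [y1 E1] [y2 E2]; exists (y1 * p2 + q1 * y2).
  by rewrite mulrDr mulrA -E1 mulrCA -E2; ring.
move=> r _; rewrite tnth_mktuple; have [->|_] := eqVneq r i; last by exists 0; rewrite subrr mulr0.
elim: (m i) => [|e [y Ey]]; first by exists 0; rewrite !expr0 subrr mulr0.
exists ('X_i ^+ e + (c *: 'X_l) * y).
by rewrite mulrDr mulrCA -Ey !exprS; ring.
Qed.

(** A linear form x_i - c x_l is prime, and does not divide x_j - c' x_l: modulo
    it, the latter remains a nonzero polynomial. *)
Lemma lin_coprime (j : 'I_3) (c' : K) a b : j != i -> j != l ->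
  ('X_j - c' *: 'X_l) * a = ('X_i - c *: 'X_l) * b ->
  exists a', a = ('X_i - c *: 'X_l) * a'.
Proof.
move=> ji jl E; have /(congr1 (comp_mpoly subst_lin)) := E.
rewrite !rmorphM !rmorphB /= !comp_mpolyZ !comp_mpolyXU -!tnth_nth !tnth_mktuple.
have li : (l == i) = false by rewrite eq_sym; exact: negbTE.
rewrite eqxx li (negbTE ji) subrr mul0r => /eqP; rewrite mulf_eq0 => /orP[/eqP H|/eqP z].
  have /(congr1 (mcoeff U_(j))) := H.
  rewrite mcoeffB mcoeffZ !mcoeffXU mcoeff0 eqxx eq_sym (negbTE jl) mulr0 subr0.
  by move/eqP; rewrite oner_eq0.
by have [y] := subst_linE a; rewrite z subr0; exists y.
Qed.
End LinearForm.
Definition cst (c : K) : Frac K := frac_of c%:MP.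
HB.instance Definition _ :=
  GRing.RMorphism.copy cst (@frac_of K \o @mpolyC 3 K).

Lemma cst_eq0 c : (cst c == 0) = (c == 0).
Proof. by rewrite frac_of_eq0 mpolyC_eq0. Qed.

Lemma Osec_cst s c : Osec 0 s (cst c).
Proof. by rewrite -[cst c]mulr1; apply: Osec_scale; exact: Osec1. Qed.

Lemma Osec_ratio s i l : l \in s -> Osec 0 s (x i / x l).
Proof. by move=> sl; apply: (Osec_mul (Osec_var s i) (Osec_varV 1 sl)). Qed.

Lemma Osec_lin n (z : Frac K) i j l c c' : i != l -> j != i -> j != l ->
  Osec n setT (z * (x i / x l - cst c)) -> Osec n setT (z * (x j / x l - cst c')) ->
  Osec n setT z.
Proof.
move=> il ji jl.
have mulE k d : z * (x k / x l - cst d) * x l = z * frac_of ('X_k - d *: 'X_l).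
  by rewrite -mulrA mulrBl divfK ?var_neq0 // frac_ofB -mul_mpolyC frac_ofM.
move=> /Osec_mul/(_ (Osec_var _ l)); rewrite mulE => H1.
move=> /Osec_mul/(_ (Osec_var _ l)); rewrite mulE => H2.
have [e1 D1] := Osec_den H1; have [e2 D2] := Osec_den H2.
have [a [k [ah ke E1]]] := D1 (maxn e1 e2) (leq_maxl _ _).
have [b [k' [bh ke' E2]]] := D2 (maxn e1 e2) (leq_maxr _ _).
move: (maxn _ _) ke ke' E1 E2 => e ke ke' E1 E2.
have lin_neq0 k0 d : k0 != l -> 'X_k0 - d *: 'X_l != 0 :> Poly K.
  move=> kl; apply/eqP=> /(congr1 (mcoeff U_(k0))).
  rewrite mcoeffB mcoeffZ !mcoeffXU mcoeff0 eqxx eq_sym (negbTE kl) mulr0 subr0.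
  by move/eqP; rewrite oner_eq0.
have Eab : ('X_j - c' *: 'X_l) * a = ('X_i - c *: 'X_l) * b.
  apply: frac_of_inj; rewrite !frac_ofM.
  rewrite (canRL (divfK (fmon_neq0 _)) (esym E1)) (canRL (divfK (fmon_neq0 _)) (esym E2)).
  by ring.
have [a' Ea] := lin_coprime il ji jl Eab.
have Ez : z = frac_of a' / fmon (ind setT *+ e).
  apply: (mulIf (x := frac_of ('X_i - c *: 'X_l))); first by rewrite frac_of_neq0 lin_neq0.
  by rewrite E1 Ea frac_ofM [frac_of _ * frac_of a']mulrC mulrAC.
have [a0|a0] := eqVneq a 0.
  have -> : z = 0.
    apply: (mulIf (x := frac_of ('X_i - c *: 'X_l))); first by rewrite frac_of_neq0 lin_neq0.
    by rewrite E1 a0 frac_of0 !mul0r.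
  by apply: Osec0; apply/set0Pn; exists o0; rewrite inE.
have lh : 'X_i - c *: 'X_l \is [in K[3], 1.-homog].
  have h1 r : 'X_r \is [in K[3], 1.-homog] by have := @homogX K U_(r); rewrite mdeg1.
  by apply: rpredB => //; apply: dhomogZ.
have [k0 kk a'h] := homog_quotient lh (lin_neq0 _ _ il) (esym Ea) ah a0.
rewrite Ez; apply: (Osec_frac a'h); first exact: ind_notin.
by rewrite mdegMn mdeg_ind; lia.
Qed.

(** A linear factor in x_i, x_l and one in x_j, x_l are coprime, so the factors
    are cancelled one at a time. *)
Lemma Osec_linprod n (z : Frac K) i j l (r1 r2 : seq K) : i != l -> j != i -> j != l ->
  Osec n setT (z * \prod_(c <- r1) (x i / x l - cst c)) ->
  Osec n setT (z * \prod_(c <- r2) (x j / x l - cst c)) -> Osec n setT z.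
Proof.
move=> il ji jl.
have Hp r k : Osec 0 setT (\prod_(c <- r) (x k / x l - cst c)).
  elim: r => [|c r IH]; first by rewrite big_nil; exact: Osec1.
  rewrite big_cons -[0]addr0; apply: Osec_mul IH.
  by apply: Osec_sub (Osec_cst _ _); apply: Osec_ratio; rewrite inE.
have one : forall r z c, Osec n setT (z * (x i / x l - cst c)) ->
    Osec n setT (z * \prod_(c <- r) (x j / x l - cst c)) -> Osec n setT z.
  elim=> [|c' r IH] y c Hc; first by rewrite big_nil mulr1.
  rewrite big_cons mulrCA mulrC => Hr; apply: (IH _ c) => //.
  apply: (Osec_lin il ji jl _ Hr (c := c)).
  by rewrite mulrAC -[n]addr0; apply: Osec_mul.
elim: r1 z => [|c r IH] z; first by rewrite big_nil mulr1.
rewrite big_cons mulrCA mulrC => Hc H2; apply: IH => //.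
apply: (one r2 _ c) => //; rewrite mulrAC -[n]addr0; exact: Osec_mul.
Qed.

Lemma mderiv_homog a k i : a \is k.-homog -> mderiv i a \is k.-1.-homog.
Proof.
move=> ah; apply/dhomogP => m; rewrite mcoeff_msupp mcoeff_mderiv => H.
have : (m + U_(i))%MM \in msupp a.
  by rewrite mcoeff_msupp; apply: contraNneq H => ->; rewrite mul0rn.
by move/(homog_mdeg ah); rewrite mdegD mdeg1 addn1 => <-.
Qed.

Lemma euler a k : a \is k.-homog -> \sum_i 'X_i * mderiv i a = a *+ k.
Proof.
move=> ah; rewrite [in RHS](mpolyE a) -sumrMnl [in LHS](mpolyE a).
under eq_bigr do rewrite raddf_sum mulr_sumr.
rewrite exchange_big /= !big_seq; apply: eq_bigr => m ma.
rewrite -(homog_mdeg ah ma) mdegE -sumrMnr; apply: eq_bigr => i _.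
rewrite mderivZ mderivX -!scalerAr scalerMnr; congr (_ *: _).
have [->|mi] := posnP (m i); first by rewrite scale0r mulr0n.
rewrite -mpolyXD scaler_nat addmC submK //.
by apply/mnm_lepP => r; rewrite mnm1E; case: eqP => [<-|].
Qed.

End Divisibility.

(** * Partial derivatives of a squarefree polynomial *)

Section Reduced.
Context {K : closedFieldType}.
Implicit Types (a b f g v : Poly K).

(** The exponents of a are divisible by p, and its coefficients are p-th powers
    since K is algebraically closed. *)
Lemma pth_root p a k : p \in [pchar K] -> a \is k.-homog ->
  (forall i, mderiv i a = 0) -> exists2 b, a = b ^+ p &
     forall l, (k = l * p)%N -> b \is l.-homog.
Proof.
move=> pK ah da; have pp := pcharf_prime pK.
have rootK (c : K) : exists r, r ^+ p == c.
  have [r Hr] := solve_monicpoly (fun i => if i == 0%N then c else 0) (prime_gt0 pp).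
  exists r; rewrite Hr; case: p pp {pK Hr} => // p _.
  by rewrite big_ord_recl /= mulr1 big1 ?addr0 // => i _; rewrite mul0r.
have pm m i : m \in msupp a -> (p %| m i)%N.
  move=> ma; case mi : (m i) => [|q]; first exact: dvdn0.
  have Um : (U_(i) <= m)%MM.
    by apply/mnm_lepP => r; rewrite mnm1E; case: eqP => [<-|//]; rewrite mi.
  have := congr1 (mcoeff (m - U_(i))%MM) (da i).
  rewrite mcoeff_mderiv submK // mnmBE mnm1E eqxx mi subn1 /= mcoeff0 -mulr_natr => /eqP.
  by rewrite mulf_eq0 -(dvdn_pcharf pK) mcoeff_eq0 ma.
pose q m : 'X_{1..3} := [multinom (m i %/ p)%N | i < 3].
have qE m : m \in msupp a -> (q m *+ p = m)%MM.
  by move=> ma; apply/mnmP=> i; rewrite mulmnE mnmE divnK ?pm.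
exists (\sum_(m <- msupp a) xchoose (rootK a@_m) *: 'X_[q m]).
  have pP : p \in [pchar Poly K] by apply: (rmorph_pchar (mpolyC 3 (R := K))).
  rewrite -(pFrobenius_autE pP) raddf_sum /= {1}[a]mpolyE !big_seq.
  apply: eq_bigr => m ma; rewrite pFrobenius_autE exprZn (eqP (xchooseP (rootK _))).
  by rewrite mpolyXn qE.
move=> l kl; rewrite big_seq; apply: rpred_sum => m ma; apply: dhomogZ.
rewrite dhomogX; apply/eqP; have := homog_mdeg ah ma.
by rewrite -{1}(qE m ma) mdegMn kl => /eqP; rewrite eqn_pmul2r ?prime_gt0 // => /eqP.
Qed.

Definition dvd a b := exists q, b = a * q.

(** The polynomials v such that f | g v form an ideal. It contains f. It contains
    the derivatives of v with v, for f | g^2 v_i, hence f | (g v_i)^2, and f is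
    squarefree; for the same reason it contains v if it contains v^p. A nonzero v
    whose derivatives vanish is constant or a p-th power; so, descending on the
    degree, the ideal contains 1. *)
Lemma dvd_of_partials f g d e :
  ([pchar K] =i pred0 \/ exists p, p \in [pchar K]) ->
  f \is d.-homog -> f != 0 -> g \is e.-homog ->
  (forall y k n, y \is k.-homog -> dvd f (y ^+ n) -> dvd f y) ->
  (forall i, dvd f (g * mderiv i f)) -> dvd f g.
Proof.
move=> charK fh f0 gh rad Hg.
suff: forall k v, v \is k.-homog -> v != 0 -> dvd f (g * v) -> dvd f g.
  by move/(_ d f fh f0); apply; exists g; rewrite mulrC.
elim/ltn_ind=> k IH v vh v0 Hv.
have [k0|k0] := posnP k.
  have [c Ec] : exists c, v = c%:MP.
    exists v@_0%MM; apply/mpolyP=> m; rewrite mcoeffC.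
    have [->|m0] := eqVneq m 0%MM; first by rewrite mulr1.
    rewrite mulr0; apply/eqP; rewrite mcoeff_eq0; apply/negP=> /(homog_mdeg vh)/eqP.
    by rewrite k0 mdeg_eq0 (negbTE m0).
  have c0 : c != 0 by apply: contra_neq v0 => c0; rewrite Ec c0 mpolyC0.
  case: Hv => q Hq; exists (c^-1 *: q).
  by rewrite -scalerAr -Hq Ec -mulrC mul_mpolyC scalerA mulVf // scale1r.
have [/forallP/= dv0|] := boolP [forall i, mderiv i v == 0]; last first.
  rewrite negb_forall => /existsP[i vi].
  apply: (IH k.-1 _ (mderiv i v)) => //; [by rewrite prednK | exact: mderiv_homog |].
  apply: (rad _ _ 2); first by apply: dhomogM gh (mderiv_homog i vh).
  case: Hv => u Hu; case: (Hg i) => w Hw.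
  exists ((w * u + g * mderiv i u - mderiv i g * u) * mderiv i v).
  have := congr1 (mderiv i) Hu; rewrite !mderivM => D.
  have -> : (g * mderiv i v) ^+ 2 = g * (g * mderiv i v) * mderiv i v by ring.
  have -> : g * mderiv i v = mderiv i f * u + f * mderiv i u - mderiv i g * v.
    by rewrite -D; ring.
  rewrite mulrA; congr (_ * _).
  have -> : g * (mderiv i f * u + f * mderiv i u - mderiv i g * v) =
    (g * mderiv i f) * u + f * (g * mderiv i u) - mderiv i g * (g * v) by ring.
  by rewrite Hw Hu; ring.
have {}dv0 i : mderiv i v = 0 by apply/eqP.
case: charK => [c0|[p pK]].
  have := euler vh; rewrite big1 => [|i _]; last by rewrite dv0 mulr0.
  move/esym/eqP; rewrite -scaler_nat scaler_eq0 (negbTE v0) orbF.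
  by rewrite ((pcharf0P K).1 c0) => /eqP kz; rewrite kz in k0.
have [b Eb Hb] := pth_root pK vh dv0.
have pp := pcharf_prime pK.
have b0 : b != 0 by apply: contra_neq v0 => z; rewrite Eb z expr0n; case: (p) pp.
have [l kl bh] : exists2 l, k = (l * p)%N & b \is l.-homog.
  have : (p %| k)%N.
    rewrite (dvdn_pcharf pK) -[_ == 0](_ : ((k%:R : K) *: v == 0) = _); last first.
      by rewrite scaler_eq0 (negbTE v0) orbF.
    rewrite scaler_nat -(euler vh) big1 // => i _; by rewrite dv0 mulr0.
  by case/dvdnP => l kl; exists l; [|exact: Hb].
apply: (IH l _ b) => //; first by rewrite kl ltn_Pmulr ?prime_gt1 //; case: l kl k0 {bh} => // ->.
apply: (rad _ (e + l)%N p); first exact: dhomogM.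
case: Hv => u Hu; exists (g ^+ p.-1 * u).
by rewrite exprMn -Eb -(prednK (prime_gt0 pp)) exprSr -mulrA Hu; ring.
Qed.

End Reduced.

(** * Differentials *)

Section Span.
Context {K : fieldType} {V : lmodType (Frac K)}.
Implicit Types (A : Frac K -> Prop) (G : V -> Prop).

Lemma span_ind A G (P : V -> Prop) : P 0 ->
  (forall v w, P v -> P w -> P (v + w)) ->
  (forall a g, A a -> G g -> P (a *: g)) -> forall v, span A G v -> P v.
Proof.
move=> P0 PD PG v [n [a [g [H ->]]]].
by elim/big_rec: _ => // i w _; apply: PD; apply: PG; case: (H i).
Qed.

Lemma span_gen A G g : A 1 -> G g -> span A G g.
Proof.
move=> A1 Gg; exists 1%N, (fun=> 1), (fun=> g); split=> //.
by rewrite big_ord1 scale1r.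
Qed.

Lemma span_add A G v w : span A G v -> span A G w -> span A G (v + w).
Proof.
move=> [n [a [g [H ->]]]] [n' [a' [g' [H' ->]]]].
exists (n + n')%N, (fun i => match split i with inl j => a j | inr j => a' j end),
  (fun i => match split i with inl j => g j | inr j => g' j end).
split; first by move=> i; case: (split i) => j.
rewrite big_split_ord; congr (_ + _); apply: eq_bigr => i _.
  by rewrite (unsplitK (inl i)).
by rewrite (unsplitK (inr i)).
Qed.

Lemma span_scale A G c v : (forall a, A a -> A (c * a)) -> span A G v ->
  span A G (c *: v).
Proof.
move=> Ac [n [a [g [H ->]]]]; exists n, (fun i => c * a i), g; split.
  by move=> i; split; [apply: Ac|]; case: (H i).
by rewrite scaler_sumr; apply: eq_bigr => i _; rewrite scalerA.
Qed.

Lemma span0 A G : span A G 0.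
Proof.
exists 0%N, (fun=> 0), (fun=> 0); split; first by case.
by rewrite big_ord0.
Qed.

End Span.

Section Derivations.
Context {K : fieldType}.
Implicit Types (a b f : Poly K) (g h : Frac K) (s t : {set 'I_3}) (n : int).
Implicit Types (u v : 'X_{1..3}).
Local Notation x := (@var K).

Lemma mderiv_homogX a k i l : a \is k.-homog -> 'X_l * mderiv i a \is k.-homog.
Proof.
move=> ah; have [a0|a0] := eqVneq (mderiv i a) 0; first by rewrite a0 mulr0 dhomog0.
have k0 : (0 < k)%N.
  case: k ah => [|//] ah; case/eqP: a0; apply/mpolyP=> r.
  rewrite mcoeff_mderiv mcoeff0; apply/eqP; rewrite -mulr_natr mulf_eq0 mcoeff_eq0.
  apply/orP; left; apply/negP=> /(homog_mdeg ah).
  by rewrite mdegD mdeg1 addn1.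
have := dhomogM (@homogX K U_(l)) (mderiv_homog i ah).
by rewrite mdeg1 add1n prednK.
Qed.

Lemma frac_X i : frac_of 'X_i = x i. Proof. by []. Qed.

Lemma partial_ratio r j l :
  partial r (x j / x l) = (j == r)%:R / x l - (l == r)%:R * x j / x l ^+ 2.
Proof.
rewrite -!frac_X partial_div ?mpolyX_neq0 // !mderivX !mnm1E.
have dX c : (c == r)%:R *: 'X_[U_(c) - U_(r)] = (c == r)%:R :> Poly K.
  have [->|_] := eqVneq c r; last by rewrite scale0r.
  rewrite scale1r (_ : (_ - _)%MM = 0%MM) ?mpolyX0 //.
  by apply/mnmP=> q; rewrite mnmBE subnn mnm0E.
rewrite !dX frac_ofB !frac_ofM !rmorph_nat !frac_X.
apply: ratio_partialE; exact: var_neq0.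
Qed.

Lemma partial_chart f d i j : j != i ->
  partial j (frac_of f / x i ^+ d) = frac_of (mderiv j f) / x i ^+ d.
Proof.
move=> ji; rewrite -frac_X -frac_ofXn partial_div ?expf_neq0 ?mpolyX_neq0 //.
have -> : mderiv j ('X_i ^+ d) = 0 :> Poly K.
  elim: (d) => [|e IH]; first by rewrite expr0 mderivC.
  rewrite exprS mderivM IH mderivX mnm1E eq_sym (negbTE ji).
  by rewrite scale0r mul0r mulr0 addr0.
rewrite mulr0 subr0 frac_ofM expr2 invfM mulrA mulfK //.
by rewrite frac_of_neq0 expf_neq0 ?mpolyX_neq0.
Qed.

Lemma Osec_partial s l j g : l \in s -> Osec 0 s g -> Osec 0 s (x l * partial j g).
Proof.
move=> ls /OsecP[a [k [e [ah ke ->]]]].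
rewrite /fmon partial_div ?mpolyX_neq0 // mulrA -frac_X -frac_ofM -frac_ofXn mpolyXn.
apply: (Osec_frac (k := (k + mdeg (ind s *+ e)%MM)%N)).
- rewrite mulrBr; apply: rpredB.
    by rewrite mulrA; apply: dhomogM; [exact: mderiv_homogX | exact: homogX].
  by rewrite mulrCA; apply: dhomogM => //; apply: mderiv_homogX; exact: homogX.
- by move=> i si; rewrite mulmnE ind_notin.
- by rewrite !mdegMn mdeg_ind; lia.
Qed.

Lemma partial_euler s g : Osec 0 s g -> \sum_j x j * partial j g = 0.
Proof.
case/OsecP=> a [k [e [ah ke ->]]]; rewrite /fmon.
under eq_bigr => j _ do rewrite partial_div ?mpolyX_neq0 // mulrA -frac_X -frac_ofM.
rewrite -mulr_suml -(rmorph_sum (frac_of (K := K))) /=.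
have -> : \sum_i 'X_i * (mderiv i a * 'X_[(ind s *+ e)] - a * mderiv i 'X_[(ind s *+ e)]) = 0.
  under eq_bigr do rewrite mulrBr mulrA mulrCA.
  rewrite sumrB -mulr_suml -mulr_sumr (euler ah) (euler (@homogX K _)).
  by rewrite mdegMn mdeg_ind mulrnAl mulrnAr (_ : k = (#|s| * e)%N) ?subrr //; lia.
by rewrite frac_of0 mul0r.
Qed.

(** The functions x_j / x_l are affine coordinates on U_l; the Euler relation
    accounts for the homogeneous coordinates. *)
Lemma diff_decomp s l g : l \in s -> Osec 0 s g ->
  diff g = \sum_j (x l * partial j g) *: diff (x j / x l).
Proof.
move=> ls /partial_euler E; apply/rowP=> r; rewrite !mxE summxE.
under eq_bigr do rewrite !mxE partial_ratio mulrBr.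
rewrite sumrB [X in _ - X](_ : _ = (l == r)%:R / x l * \sum_j x j * partial j g).
  rewrite E mulr0 subr0 (bigD1 r) //= big1 => [|j jr].
    by rewrite eqxx addr0 mul1r mulrAC mulfV ?var_neq0 // mul1r.
  by rewrite (negbTE jr) mul0r mulr0.
rewrite mulr_sumr; apply: eq_bigr => j _.
apply: diff_decompE; exact: var_neq0.
Qed.

End Derivations.

(** * The vector field of a foliation *)

Section Foliation.
Context {K : fieldType}.
Variables (m : int) (eta : Diff K -> Frac K).
Hypothesis fol : is_foliation m eta.
Implicit Types (s : {set 'I_3}) (w : Diff K) (g : Frac K).
Local Notation x := (@var K).

Lemma Omega_add s w w' : Omega s w -> Omega s w' -> Omega s (w + w').
Proof. exact: span_add. Qed.

Lemma Omega_scale s a w : Osec 0 s a -> Omega s w -> Omega s (a *: w).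
Proof. by move=> sa; apply: span_scale => b; rewrite -[0]addr0; apply: Osec_mul. Qed.

Lemma Omega_diff s g : Osec 0 s g -> Omega s (diff g).
Proof. by move=> sg; apply: span_gen; [exact: Osec1 | exists g]. Qed.

Lemma eta_lin s a w w' : s != set0 -> Osec 0 s a -> Omega s w -> Omega s w' ->
  eta (a *: w + w') = a * eta w + eta w'.
Proof. by case: fol => _ H _; apply: H. Qed.

Lemma eta0 : eta 0 = 0.
Proof.
have s0 : [set o0] != set0 by rewrite -card_gt0 cards1.
have H := @eta_lin _ 1 0 0 s0 (Osec1 _) (span0 _ _) (span0 _ _).
by move: H; rewrite scaler0 addr0 mul1r => E; apply: (addrI (eta 0)); rewrite addr0 -E.
Qed.

(** If eta is induced by a vector field A, this is x_i A_j - x_j A_i. *)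
Definition fol_coef (i j : 'I_3) : Frac K := x i ^+ 2 * eta (diff (x j / x i)).

Lemma eta_diff s i g : i \in s -> Osec 0 s g ->
  eta (diff g) = \sum_j partial j g * fol_coef i j / x i.
Proof.
move=> si sg; have s0 : s != set0 by apply/set0Pn; exists i.
rewrite (diff_decomp si sg) !sum3.
have O j : Omega s (diff (x j / x i)) by apply/Omega_diff/Osec_ratio.
have D j : Osec 0 s (x i * partial j g) by apply: Osec_partial.
have S j w : Omega s w -> eta ((x i * partial j g) *: diff (x j / x i) + w)
    = partial j g * fol_coef i j / x i + eta w.
  move=> Ow; rewrite (eta_lin s0) // /fol_coef; congr (_ + _).
  apply: eta_diffE; exact: var_neq0.
have O' j := Omega_scale (D j) (O j).
rewrite -addrA -[(x i * partial o2 g) *: _]addr0.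
rewrite (S o0) ?(S o1) ?(S o2) ?(eta0, addr0, addrA) //;
  do ?[exact: O' | exact: span0 | apply: Omega_add].
Qed.

(** The relation between the three functions x_j / x_i, x_l / x_i and
    x_l / x_j, transported by eta. *)
Lemma fol_coef_koszul i j l :
  x i * fol_coef j l = x j * fol_coef i l - x l * fol_coef i j.
Proof.
have iT : i \in setT by rewrite inE.
have jT : j \in setT by rewrite inE.
rewrite {1}/fol_coef (eta_diff iT (Osec_ratio l jT)).
under eq_bigr do rewrite partial_ratio.
have xi := var_neq0 (K := K) i; have xj := var_neq0 (K := K) j.
have -> : \sum_r ((l == r)%:R / x j - (j == r)%:R * x l / x j ^+ 2) * fol_coef i r / x i
   = (fol_coef i l / x j - x l * fol_coef i j / x j ^+ 2) / x i.
  rewrite -mulr_suml; congr (_ / _).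
  under eq_bigr do rewrite mulrBl.
  rewrite sumrB (bigD1 l) //= big1 ?addr0 => [|r rl]; last by rewrite eq_sym (negbTE rl) !mul0r.
  rewrite (bigD1 j) //= big1 ?addr0 => [|r rl]; last by rewrite eq_sym (negbTE rl) !mul0r.
  by rewrite !eqxx !mul1r mulrC; congr (_ - _); rewrite mulrAC.
exact: (@koszulE (Frac K) (fol_coef i l) (x l) (fol_coef i j) (x i) (x j) xi xj).
Qed.

Lemma fol_coefii i : fol_coef i i = 0.
Proof.
have -> : fol_coef i i = x i ^+ 2 * eta (diff (x i / x i)) by [].
rewrite (_ : diff _ = 0) ?eta0 ?mulr0 //; apply/rowP=> r; rewrite !mxE partial_ratio.
apply: const_ratioE; exact: var_neq0.
Qed.

Lemma fol_coefC i j : fol_coef j i = - fol_coef i j.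
Proof.
apply: (mulfI (var_neq0 i)); rewrite fol_coef_koszul fol_coefii.
by rewrite mulr0 sub0r mulrN.
Qed.

Lemma fol_coef_sec i j : Osec (m + 1) [set i] (fol_coef i j).
Proof.
have s0 : [set i] != set0 by rewrite -card_gt0 cards1.
case: fol => H _ _; rewrite (_ : m + 1 = 2 + (m - 1)); last by ring.
apply: Osec_mul (Osec_varX _ _ _) _.
by apply: H => //; apply/Omega_diff/Osec_ratio; rewrite inE.
Qed.

End Foliation.

Section Leaf.
Context {K : fieldType}.
Variables (d : nat) (f : Poly K) (m : int) (eta : Diff K -> Frac K).
Hypotheses (fh : f \is d.-homog) (f0 : f != 0) (d0 : d%:R != 0 :> K).
Hypothesis fol : is_foliation m eta.
Hypothesis leaf : factors_through_Omega_C m eta (curve_ideal d f).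
Local Notation x := (@var K).
Local Notation F := (frac_of f).
Local Notation G := (fol_coef eta).
Local Notation grad j := (frac_of (mderiv j f)).

Lemma euler_grad : \sum_j x j * grad j = d%:R * F.
Proof.
rewrite mulr_natl -(raddfMn (frac_of (K := K))) -(euler fh) raddf_sum /=.
by apply: eq_bigr => j _; exact/esym/frac_ofM.
Qed.

Lemma dF_neq0 : d%:R * F != 0.
Proof. by rewrite mulf_neq0 ?frac_of_neq0 // -(rmorph_nat (cst (K := K))) cst_eq0. Qed.

(** The differential of the local equation f / x_i^d dies in Omega^1_C, so eta
    sends it to a multiple of f. *)
Lemma leaf_coef i : exists2 h, Osec m [set i] h & \sum_j G i j * grad j = F * h.
Proof.
have s0 : [set i] != set0 by rewrite -card_gt0 cards1.
have si : i \in [set i] by rewrite inE.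
pose g := F * x i ^- d.
have xd : Osec (- d%:Z) [set i] (x i ^- d) by apply: Osec_varV.
have sg : Osec 0 [set i] g.
  by rewrite -(addrN d%:Z); apply: Osec_mul => //; exact: Osec_poly fh _.
have [h sh Eh] : exists2 h, Osec (m - 1 - d%:Z) [set i] h & eta (diff g) = F * h.
  have /leaf : ker_to_Omega_C (curve_ideal d f) [set i] (diff g).
    apply: span_gen; first exact: Osec1.
    by right; exists g => //; exists (x i ^- d).
  move/(_ s0); apply: (span_ind (V := (Frac K)^o)
    (P := fun e => exists2 h, Osec (m - 1 - d%:Z) [set i] h & e = F * h)).
  - by exists 0; [exact: Osec0 | rewrite mulr0].
  - move=> _ _ [h1 H1 ->] [h2 H2 ->]; exists (h1 + h2); first exact: Osec_add.
    by rewrite mulrDr.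
  move=> a _ sa [_ [b [[h sh ->] sb ->]]]; exists (a * (h * b)).
    rewrite (_ : m - 1 - d%:Z = 0 + (- d%:Z + (m - 1))); last by ring.
    by do 2!apply: Osec_mul => //.
  by rewrite /GRing.scale /=; ring.
exists (x i ^+ d.+1 * h).
  rewrite (_ : m = d.+1%:Z + (m - 1 - d%:Z)); last by lia.
  by apply: Osec_mul => //; exact: Osec_varX.
rewrite mulrCA -Eh (eta_diff fol si sg) mulr_sumr.
apply: eq_bigr => j _; have xi := var_neq0 (K := K) i.
have [->|ji] := eqVneq j i; first by rewrite (fol_coefii fol) // !(mulr0, mul0r).
rewrite partial_chart // exprS.
exact: (@leaf_coefE (Frac K) (grad j) (G i j) (x i) (x i ^+ d) xi (expf_neq0 _ xi)).
Qed.

(** The vector field A which induces eta and annihilates f; the last condition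
    removes the ambiguity by multiples of the Euler field. The formula is the
    solution of x_i A_j - x_j A_i = G i j with sum_j A_j f_j = 0, by means of the
    Euler relation sum_j x_j f_j = d f. *)
Definition vf (i : 'I_3) : Frac K := - (\sum_j G i j * grad j) / (d%:R * F).

Lemma vfE i : vf i * (d%:R * F) = - (\sum_j G i j * grad j).
Proof. by rewrite /vf divfK ?dF_neq0. Qed.

Lemma vf_coef i j : x i * vf j - x j * vf i = G i j.
Proof.
apply: (mulIf dF_neq0); rewrite mulrBl -(mulrA (x i)) -(mulrA (x j)) !vfE.
rewrite -[in RHS]euler_grad mulr_sumr !mulrN opprK !mulr_sumr -sumrN -big_split.
apply: eq_bigr => l _;
exact: (@vf_coefE (Frac K) (x i) (G j l) (x j) (G i l) (x l) (G i j) (grad l)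
  (fol_coef_koszul fol i j l)).
Qed.

Lemma vf_grad : \sum_i vf i * grad i = 0.
Proof.
apply: (mulIf dF_neq0); rewrite mul0r mulr_suml.
under eq_bigr do rewrite (mulrAC (vf _)) vfE.
rewrite !sum3 (fol_coefC fol o0 o1) (fol_coefC fol o0 o2) (fol_coefC fol o1 o2).
by rewrite !(fol_coefii fol); ring.
Qed.

Lemma eta_vf s w : s != set0 -> Omega s w -> eta w = \sum_j vf j * w ord0 j.
Proof.
move=> s0; have [i si] := set0Pn _ s0.
suff H : Omega s w -> Omega s w /\ eta w = \sum_j vf j * w ord0 j by case/H.
apply: (span_ind (P := fun w => Omega s w /\ eta w = \sum_j vf j * w ord0 j)).
- split; first exact: span0.
  by rewrite (eta0 fol) big1 // => j _; rewrite mxE mulr0.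
- move=> v v' [Ov Ev] [Ov' Ev']; split; first exact: Omega_add.
  rewrite -[v]scale1r (eta_lin fol s0 (Osec1 s)) // mul1r Ev Ev' -big_split.
  by apply: eq_bigr => j _; rewrite !mxE /= mul1r mulrDr.
move=> a _ sa [g sg ->]; have Og := Omega_diff sg.
split; first exact: Omega_scale.
rewrite -[_ *: _]addr0 (eta_lin fol s0) ?(eta0 fol) ?addr0 //; last exact: span0.
under [RHS]eq_bigr do rewrite !mxE mulrCA.
rewrite -mulr_sumr (eta_diff fol si sg); congr (_ * _).
have xi := var_neq0 (K := K) i.
have E := partial_euler sg.
under eq_bigr do rewrite -vf_coef.
have E' : \sum_j vf i / x i * (x j * partial j g) = 0 by rewrite -mulr_sumr E mulr0.
rewrite -[RHS]subr0 -[X in _ = _ - X]E' -sumrB; apply: eq_bigr => j _.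
exact: (@eta_vfE (Frac K) (partial j g) (vf j) (x j) (vf i) (x i) xi).
Qed.

Lemma vf_neq0 : exists i, vf i != 0.
Proof.
apply/existsP; rewrite -[[exists _, _]]negbK; apply/negP=> /existsPn z.
case: fol => _ _ [s [w [s0 sw /eqP[]]]]; rewrite (eta_vf s0 sw) big1 // => i _.
by move: (z i); rewrite negbK => /eqP->; rewrite mul0r.
Qed.

(** A_i is regular on U_i because the curve is a leaf, and also on U_j because
    A_j and x_i A_j - x_j A_i are; so it has no pole. *)
Lemma vf_poly : exists2 a : 'I_3 -> Poly K, forall i, vf i = frac_of (a i) &
  exists M : nat, m = M /\ forall i, a i \is M.-homog.
Proof.
have S1 i : Osec m [set i] (vf i).
  have [h sh E] := leaf_coef i.
  have -> : vf i = cst (- (d%:R)^-1) * h.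
    rewrite /vf E rmorphN fmorphV rmorph_nat.
    have := dF_neq0; rewrite mulf_eq0 negb_or => /andP[d1 F0].
    exact: (@vf_chartE (Frac K) d%:R F h d1 F0).
  by rewrite -[m]add0r; apply: Osec_mul (Osec_cst _ _) sh.
have S2 i j : j != i -> Osec m [set j] (vf i).
  move=> ji; have -> : vf i = (x i * vf j - G i j) * x j ^- 1.
    rewrite -vf_coef.
    exact: (@vf_other_chartE (Frac K) (vf i) (vf j) (x i) (x j) (var_neq0 j)).
  rewrite (_ : m = m + 1 + - 1%:Z); last by rewrite addrK.
  apply: Osec_mul; last by apply: Osec_varV; rewrite inE.
  apply: Osec_sub; first by rewrite addrC; apply: Osec_mul => //; exact: Osec_var.
  by rewrite (fol_coefC fol j i); apply/Osec_opp/fol_coef_sec.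
have S i : vf i = 0 \/ Osec m set0 (vf i).
  have [j ji] : exists j, j != i by move: i; apply: all3; [exists o1|exists o0|exists o0].
  have := Osec_inter (S1 i) (S2 i j ji).
  suff -> : [set i] :&: [set j] = set0 by [].
  by apply/setP=> r; rewrite !inE; case: eqP => // ->; rewrite eq_sym (negbTE ji).
have P i : Osec m set0 (vf i) ->
    exists M : nat, m = M /\ exists2 a, vf i = frac_of a & a \is M.-homog.
  case/OsecP=> a [k [e [ah ke E]]]; exists k; split; first by rewrite cards0 in ke; lia.
  exists a => //; rewrite E (_ : (ind _ *+ e)%MM = 0%MM) ?fmon0 ?divr1 //.
  by apply/mnmP=> r; rewrite mulmnE mnmE inE mul0n mnm0E.
have [i Hi] := vf_neq0.
have [M [mM _]] : exists M : nat, m = M /\ exists2 a, vf i = frac_of a & a \is M.-homog.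
  by case: (S i) => [z|/P //]; rewrite z eqxx in Hi.
have Q i' : exists a, (vf i' == frac_of a) && (a \is M.-homog).
  case: (S i') => [z|/P[M' [mM' [a E ah]]]].
    by exists 0; rewrite z frac_of0 eqxx dhomog0.
  have MM : M = M' by apply: (can_inj absz_nat); rewrite -mM -mM'.
  by exists a; rewrite E eqxx MM.
exists (fun i => xchoose (Q i)) => [i'|]; first by case/andP: (xchooseP (Q i')) => /eqP.
by exists M; split=> // i'; case/andP: (xchooseP (Q i')).
Qed.

End Leaf.

(** * Cross products *)

Section Vectors.
Context {F : fieldType}.
Implicit Types (u v w : 'I_3 -> F).

Definition dot u v := \sum_i u i * v i.
Definition cross u v (i : 'I_3) := match val i with
  | 0%N => u o1 * v o2 - u o2 * v o1
  | 1%N => u o2 * v o0 - u o0 * v o2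
  | _ => u o0 * v o1 - u o1 * v o0 end.

Lemma dotE u v : dot u v = u o0 * v o0 + u o1 * v o1 + u o2 * v o2.
Proof. exact: sum3. Qed.

Lemma dotDl u v w : dot (fun i => u i + v i) w = dot u w + dot v w.
Proof. by rewrite !dotE; ring. Qed.

Lemma dotBl u v w : dot (fun i => u i - v i) w = dot u w - dot v w.
Proof. by rewrite !dotE; ring. Qed.

Lemma dotZl a u w : dot (fun i => a * u i) w = a * dot u w.
Proof. by rewrite !dotE; ring. Qed.

Lemma dot_cross u v : dot (cross u v) v = 0.
Proof. by rewrite dotE /cross /=; ring. Qed.

Lemma cross_ext u u' w i : u =1 u' -> cross u w i = cross u' w i.
Proof. by move=> E; rewrite /cross !E. Qed.

Lemma crossDl u v w i : cross (fun i => u i + v i) w i = cross u w i + cross v w i.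
Proof. by move: i; apply: all3; rewrite /cross /=; ring. Qed.

Lemma crossBl u v w i : cross (fun i => u i - v i) w i = cross u w i - cross v w i.
Proof. by move: i; apply: all3; rewrite /cross /=; ring. Qed.

Lemma crossZl a u w i : cross (fun i => a * u i) w i = a * cross u w i.
Proof. by move: i; apply: all3; rewrite /cross /=; ring. Qed.

Lemma cross_cross u v w i :
  cross (cross u v) w i = dot u w * v i - u i * dot v w.
Proof. by move: i; apply: all3; rewrite !dotE /cross /=; ring. Qed.

Lemma cross_eq0 u v : (forall i, cross u v i = 0) -> (exists i, v i != 0) ->
  exists q, forall i, u i = q * v i.
Proof.
move=> H [l vl]; exists (u l / v l) => i; apply: (mulIf vl).
rewrite mulrAC divfK //.
have := H o0; have := H o1; have := H o2; rewrite /cross /=.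
move=> /subr0_eq E2 /subr0_eq E1 /subr0_eq E0.
move: i; apply: all3; move: l {vl}; apply: all3; rewrite ?E0 ?E1 ?E2 //.
Qed.

Lemma cross_parallel u w v : dot u v = 0 -> dot w v = 0 -> (exists i, v i != 0) ->
  exists h, forall i, cross u w i = h * v i.
Proof.
move=> uv wv; apply: cross_eq0 => i; rewrite cross_cross uv wv; ring.
Qed.

End Vectors.
Arguments dot : simpl never.
Arguments cross : simpl never.

(** * The singular scheme of a reduced curve *)

Section Curve.
Context {K : closedFieldType}.
Variables (d : nat) (f : Poly K).
Hypotheses (fh : f \is d.-homog) (f0 : f != 0) (d0 : d%:R != 0 :> K).
Hypothesis charK : [pchar K] =i pred0 \/ exists p, p \in [pchar K].
Hypothesis fred : is_reduced (curve_ideal d f).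
Local Notation x := (@var K).
Local Notation F := (frac_of f).

Definition grad (j : 'I_3) : Frac K := frac_of (mderiv j f).

(** Reducedness gives f | y up to a power of x_i, for i = 0 and for i = 1;
    these powers are coprime. *)
Lemma dvd_radical y k n : y \is k.-homog -> dvd f (y ^+ n) -> dvd f y.
Proof.
move=> yh [q Eq]; have [->|y0] := eqVneq y 0; first by exists 0; rewrite mulr0.
have F0 : F != 0 by rewrite frac_of_neq0.
have H i : Osec (k%:Z - d%:Z) [set i] (frac_of y / F).
  have si : i \in [set i] by rewrite inE.
  have xk : Osec (- k%:Z) [set i] (x i ^- k) by apply: Osec_varV.
  have yk : Osec k%:Z [set i] (frac_of y) by exact: Osec_poly yh _.
  have [l kl qh] := homog_quotient fh f0 (esym Eq) (dhomogMn n yh) (expf_neq0 n y0).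
  have [|||h sh Eh] := @fred [set i] (frac_of y * x i ^- k) n.
  - by apply/set0Pn; exists i.
  - by rewrite -(addrN k%:Z); apply: Osec_mul.
  - exists (frac_of q * x i ^- (k * n)).
      rewrite (_ : - d%:Z = l%:Z - (k * n)%N%:Z); last by lia.
      by apply: Osec_mul (Osec_varV _ si); exact: Osec_poly qh _.
    by rewrite exprMn exprVn -exprM -frac_ofXn Eq frac_ofM mulrA.
  have -> : frac_of y / F = h * x i ^+ k.
    exact: (@div_swapE (Frac K) (frac_of y) F h (x i ^+ k) F0 (expf_neq0 _ (var_neq0 i)) Eh).
  by rewrite addrC; apply: Osec_mul sh (Osec_varX _ _ _).
have [|] := Osec_inter (H o0) (H o1).
  by move/eqP; rewrite mulf_eq0 invr_eq0 !frac_of_eq0 (negbTE y0) (negbTE f0).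
rewrite (_ : _ :&: _ = set0); last by apply/setP; apply: all3; rewrite !inE.
case/OsecP=> a [l [e [ah _ E]]]; exists a; apply: frac_of_inj.
rewrite frac_ofM -[LHS](divfK F0) E (_ : (ind _ *+ e)%MM = 0%MM) ?fmon0 ?divr1 1?mulrC //.
by apply/mnmP=> r; rewrite mulmnE mnmE inE mul0n mnm0E.
Qed.

Lemma grad_euler : dot x grad = d%:R * F.
Proof. exact: euler_grad. Qed.

Lemma grad_neq0 : exists j, grad j != 0.
Proof.
apply/existsP; rewrite -[[exists _, _]]negbK; apply/negP=> /existsPn z.
have := dF_neq0 f0 d0; rewrite -grad_euler /dot big1 ?eqxx // => j _.
by move: (z j); rewrite negbK => /eqP->; rewrite mulr0.
Qed.

(** The partial derivatives of f have no common factor: if the products of h with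
    all of them are regular, then so is g = h f by the Euler relation, and f
    divides g f_i for all i, hence g. *)
Lemma Osec_grad_cancel n s h : s != set0 ->
  (forall i, Osec (n + d%:Z - 1) s (h * grad i)) -> Osec n s h.
Proof.
move=> s0 H; have F0 : F != 0 by rewrite frac_of_neq0.
have HF : Osec (n + d%:Z) s (h * F).
  have -> : h * F = cst (d%:R)^-1 * \sum_i x i * (h * grad i).
    have := grad_euler; rewrite /dot => E.
    under eq_bigr do rewrite mulrCA.
    rewrite -mulr_sumr E fmorphV rmorph_nat.
    have := dF_neq0 f0 d0; rewrite mulf_eq0 negb_or => /andP[dF _].
    exact: (@euler_inverseE (Frac K) d%:R h F dF).
  rewrite -[_ + _]add0r; apply: Osec_mul (Osec_cst _ _) _.
  apply: Osec_sum => // i _; rewrite (_ : n + d%:Z = 1 + (n + d%:Z - 1)); last by ring.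
  by apply: Osec_mul (Osec_var _ _) _.
have [e [[g [k [gh ke Eg]]] Hu]] : exists e, (exists a k, [/\ a \is k.-homog,
    k%:Z = n + d%:Z + (e * #|s|)%:Z & h * F = frac_of a / fmon (ind s *+ e)]) /\
    forall i, exists u, h * grad i = frac_of u / fmon (ind s *+ e).
  have [e0 H0] := Osec_den (H o0); have [e1 H1] := Osec_den (H o1).
  have [e2 H2] := Osec_den (H o2); have [e3 H3] := Osec_den HF.
  exists (e0 + e1 + e2 + e3)%N; split; first by apply: H3; lia.
  apply: all3.
  - by have [|b [k [_ _ ->]]] := H0 (e0 + e1 + e2 + e3)%N; [lia | exists b].
  - by have [|b [k [_ _ ->]]] := H1 (e0 + e1 + e2 + e3)%N; [lia | exists b].
  - by have [|b [k [_ _ ->]]] := H2 (e0 + e1 + e2 + e3)%N; [lia | exists b].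
have [q Eq] : dvd f g.
  apply: (dvd_of_partials charK fh f0 gh dvd_radical) => i.
  have [u Eu] := Hu i; exists u; apply: frac_of_inj; rewrite !frac_ofM.
  have Y0 := fmon_neq0 (K := K) (ind s *+ e).
  rewrite (canRL (divfK Y0) (esym Eg)) (canRL (divfK Y0) (esym Eu)) -/(grad i).
  by ring.
have Eh : h = frac_of q / fmon (ind s *+ e).
  by apply: (mulIf F0); rewrite Eg Eq frac_ofM [F * _]mulrC mulrAC.
have [g0|g0] := eqVneq g 0.
  suff -> : h = 0 by exact: Osec0.
  by apply: (mulIf F0); rewrite Eg g0 frac_of0 !mul0r.
have [l kl qh] := homog_quotient fh f0 (esym Eq) gh g0.
rewrite Eh; apply: (Osec_frac qh); first exact: ind_notin.
by rewrite mdegMn mdeg_ind; lia.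
Qed.

(** For a = grad f, this is I_Sigma(n + d - 1); for a vector field of degree m,
    the twist by n + m of the ideal generated by its components. *)
Definition comb (a : 'I_3 -> Frac K) (n : int) (s : {set 'I_3}) (g : Frac K) : Prop :=
  exists2 b : 'I_3 -> Frac K, forall i, Osec n s (b i) & g = dot b a.

Lemma comb_add a n s g h : comb a n s g -> comb a n s h -> comb a n s (g + h).
Proof.
move=> [b Hb ->] [c Hc ->]; exists (fun i => b i + c i); last by rewrite dotDl.
by move=> i; apply: Osec_add.
Qed.

Lemma comb_scale a n n' s c g : Osec n' s c -> comb a n s g -> comb a (n' + n) s (c * g).
Proof.
move=> sc [b Hb ->]; exists (fun i => c * b i); last by rewrite dotZl.
by move=> i; apply: Osec_mul.
Qed.

Lemma comb0 a n s : s != set0 -> comb a n s 0.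
Proof.
move=> s0; exists (fun=> 0); first by move=> _; apply: Osec0.
by rewrite dotE !mul0r !addr0.
Qed.

(** The f_j generate the twists of the ideal of the singular locus; f itself is
    redundant by the Euler relation, d being invertible. *)
Lemma twist_sing n s g : s != set0 ->
  twist (curve_sing_ideal d f) n s g <-> comb grad (n - d%:Z + 1) s g.
Proof.
move=> s0; have dn0 : d%:R != 0 :> Frac K by rewrite -(rmorph_nat (cst (K := K))) cst_eq0.
have Eg i j : j != i -> x i * partial j (F / x i ^+ d) = grad j * (x i ^- d * x i).
  by move=> ji; rewrite partial_chart // mulrC mulrA.
split.
  apply: (span_ind (V := (Frac K)^o) (P := comb grad (n - d%:Z + 1) s)).
  - exact: comb0.
  - by move=> v w; apply: comb_add.
  move=> a _ sa [h [b [Ih sb ->]]]; rewrite /GRing.scale /=.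
  suff H : comb grad (- d%:Z + 1) s h.
    rewrite mulrA (_ : n - d%:Z + 1 = 0 + n + (- d%:Z + 1)); last by ring.
    by rewrite mulrAC; apply: comb_scale H; apply: Osec_mul.
  move: h Ih; apply: (span_ind (V := (Frac K)^o) (P := comb grad (- d%:Z + 1) s)).
  - exact: comb0.
  - by move=> v w; apply: comb_add.
  move=> {sa}a {sb}_ sa [i si [->|[j ji ->]]]; rewrite -[- d%:Z + 1]add0r;
    apply: comb_scale => //.
    exists (fun j => (cst (d%:R)^-1 * x i ^- d) * x j); last first.
      rewrite dotZl grad_euler fmorphV rmorph_nat.
      exact: (@euler_chartE (Frac K) d%:R F (x i ^+ d) dn0).
    move=> j; rewrite -[- _]add0r; apply: Osec_mul (Osec_var _ _).
    by apply: Osec_mul (Osec_cst _ _) _; exact: Osec_varV.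
  exists (fun r => (r == j)%:R * (x i ^- d * x i)).
    move=> r; case: eqP => _; rewrite ?mul1r ?mul0r; last exact: Osec0.
    by apply: Osec_mul (Osec_var _ _); exact: Osec_varV.
  rewrite Eg // /dot (bigD1 j) //= big1 => [|r /negbTE->]; last by rewrite !mul0r.
  by rewrite eqxx addr0 mul1r mulrC.
case=> b Hb ->; have [i si] := set0Pn _ s0.
have gen j : curve_sing_ideal d f s (grad j * (x i ^- d * x i)).
  have O0 k : Osec 0 s (x k * x i ^- 1).
    by rewrite -(addrN 1); apply: Osec_mul (Osec_var _ _) (Osec_varV 1 si).
  have gen1 r : r != i -> curve_sing_ideal d f s (grad r * (x i ^- d * x i)).
    move=> ri; apply: span_gen; first exact: Osec1.
    exists i => //; right; exists r; rewrite ?Eg //.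
  have genf : curve_sing_ideal d f s (F / x i ^+ d).
    by apply: span_gen; [exact: Osec1 | exists i => //; left].
  have [->|] := eqVneq j i; last exact: gen1.
  have E : grad i * (x i ^- d * x i) = cst d%:R * (F / x i ^+ d)
      + \sum_(r | r != i) (- (x r * x i ^- 1)) * (grad r * (x i ^- d * x i)).
    have := grad_euler; rewrite /dot (bigD1 i) //= => /(canRL (addrK _)) E.
    rewrite rmorph_nat mulrCA [grad i * _]mulrC E mulrBr.
    congr (_ + _); first by rewrite mulrCA [_ * F]mulrC.
    rewrite mulr_sumr -sumrN; apply: eq_bigr => r _.
    exact: (@euler_termE (Frac K) (grad r) (x r) (x i) (x i ^- d) (var_neq0 i)).
  rewrite E; apply: span_add.
    by apply: span_scale genf => c; rewrite -[0]addr0; apply: Osec_mul; exact: Osec_cst.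
  elim/big_rec: _ => [|r y ri Hy]; first exact: span0.
  apply: span_add => //; apply: span_scale (gen1 r ri) => c.
  by rewrite -[0]addr0; apply: Osec_mul; apply: Osec_opp.
have Hj j : twist (curve_sing_ideal d f) n s (b j * grad j).
  have xi := var_neq0 (K := K) i.
  rewrite (@rescaleE (Frac K) (grad j) (b j) (x i) (x i ^+ d) xi (expf_neq0 _ xi)).
  apply: span_gen; first exact: Osec1.
  exists (grad j * (x i ^- d * x i)), (b j * x i ^+ d / x i).
  split; [exact: gen | | by []].
  rewrite (_ : n = (n - d%:Z + 1) + d%:Z + - 1%:Z); last by ring.
  apply: Osec_mul; last by rewrite -[x i]expr1; apply: Osec_varV.
  by apply: Osec_mul => //; apply: Osec_varX.
rewrite /dot sum3; apply: span_add (Hj o2); exact: span_add (Hj o0) (Hj o1).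
Qed.

End Curve.

(** * Cech cohomology in degrees 1 and 2 *)

Section Cech.
Context {K : fieldType}.
Implicit Types (F : {set 'I_3} -> Frac K -> Prop).

Definition cech1 F := forall c01 c02 c12,
  F [set o0; o1] c01 -> F [set o0; o2] c02 -> F [set o1; o2] c12 ->
  c12 - c02 + c01 = 0 ->
  exists b : 'I_3 -> Frac K, [/\ forall i, F [set i] (b i), c01 = b o1 - b o0,
    c02 = b o2 - b o0 & c12 = b o2 - b o1].

Definition cech2 F := forall c, F setT c -> exists c01 c02 c12,
  [/\ F [set o0; o1] c01, F [set o0; o2] c02, F [set o1; o2] c12
    & c = c12 - c02 + c01].

Definition idx1 (i : 'I_3) : {ffun 'I_1 -> 'I_3} := [ffun=> i].
Definition idx2 (i j : 'I_3) : {ffun 'I_2 -> 'I_3} :=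
  [ffun r : 'I_2 => if r == ord0 then i else j].
Definition idx3 : {ffun 'I_3 -> 'I_3} := [ffun r => r].

Lemma idx1E (t : {ffun 'I_1 -> 'I_3}) : t = idx1 (t ord0).
Proof. by apply/ffunP=> i; rewrite ffunE (ord1 i). Qed.

Lemma idx2E (t : {ffun 'I_2 -> 'I_3}) : t = idx2 (t ord0) (t ord_max).
Proof.
apply/ffunP=> i; rewrite ffunE; case: eqP => [->//|ne]; congr (t _).
by apply: val_inj; case: i ne => [[|[|//]]] //= p []; apply: val_inj.
Qed.

Lemma increasing1 i : increasing (idx1 i).
Proof. by move=> a b; rewrite (ord1 a) (ord1 b). Qed.

Lemma increasing2 (i j : 'I_3) : (i < j)%N -> increasing (idx2 i j).
Proof. by move=> ij [[|[|//]]] p [[|[|//]]] q //= _; rewrite !ffunE. Qed.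

Lemma increasing3 : increasing idx3.
Proof. by move=> a b; rewrite !ffunE. Qed.

Lemma increasing2P (t : {ffun 'I_2 -> 'I_3}) : increasing t ->
  [\/ t = idx2 o0 o1, t = idx2 o0 o2 | t = idx2 o1 o2].
Proof.
move=> /(_ ord0 ord_max isT); have := idx2E t; move: (t ord0) (t ord_max) => i j ->.
by move: i j; apply: all3; apply: all3 => //= _;
  [constructor 1 | constructor 2 | constructor 3].
Qed.

Lemma increasing3P (t : {ffun 'I_3 -> 'I_3}) : increasing t -> t = idx3.
Proof.
move=> H; have H1 := H o0 o1 isT; have H2 := H o1 o2 isT.
have H3 := ltn_ord (t o2).
apply/ffunP; apply: all3; rewrite ffunE; apply: val_inj => /=; lia.
Qed.

(** There are only three indices, so the cohomology vanishes in degrees above 2. *)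
Lemma increasing_le q (t : {ffun 'I_q.+1 -> 'I_3}) : increasing t -> (q <= 2)%N.
Proof.
move=> H; rewrite leqNgt; apply/negP=> q2.
have lt k : (k <= 3)%N -> (k < q.+1)%N by lia.
have h k l : (k < l)%N -> (l <= 3)%N -> (t (inord k) < t (inord l))%N.
  by move=> kl l3; apply: H; rewrite !inordK ?lt //; lia.
have := h 0%N 1%N isT isT; have := h 1%N 2%N isT isT; have := h 2%N 3%N isT isT.
by have := ltn_ord (t (inord 3)); lia.
Qed.

Lemma im_idx1 i : [set idx1 i r | r : 'I_1] = [set i].
Proof.
apply/setP=> l; rewrite inE; apply/imsetP/eqP => [[r _ ->]|->]; first by rewrite ffunE.
by exists ord0; rewrite ?ffunE.
Qed.

Lemma im_idx2 i j : [set idx2 i j r | r : 'I_2] = [set i; j].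
Proof.
apply/setP=> l; rewrite !inE; apply/imsetP/orP => [[r _ ->]|[]/eqP->].
- by rewrite ffunE; case: (r == ord0); rewrite eqxx; [left|right].
- by exists ord0; rewrite ?ffunE.
- by exists ord_max; rewrite ?ffunE.
Qed.

Lemma im_idx3 : [set idx3 r | r : 'I_3] = setT.
Proof.
by apply/setP=> l; rewrite !inE; apply/imsetP; exists l; rewrite ?ffunE.
Qed.

Lemma coboundary0 (b : {ffun 'I_1 -> 'I_3} -> Frac K) i j :
  coboundary b (idx2 i j) = b (idx1 j) - b (idx1 i).
Proof.
rewrite /coboundary !big_ord_recl big_ord0 addr0 expr0 expr1 mul1r mulN1r.
by congr (b _ - b _); apply/ffunP=> r; rewrite (ord1 r) !ffunE.
Qed.

Lemma coboundary1 (b : {ffun 'I_2 -> 'I_3} -> Frac K) :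
  coboundary b idx3 = b (idx2 o1 o2) - b (idx2 o0 o2) + b (idx2 o0 o1).
Proof.
rewrite /coboundary !big_ord_recl big_ord0 addr0 expr0 mul1r expr1 mulN1r addrA.
rewrite /= expr2 mulrNN mulr1 mul1r.
by congr (b _ - b _ + b _); apply/ffunP=> -[[|[|//]]] p; rewrite !ffunE; apply: val_inj.
Qed.

Lemma HS0P F : HS_vanishes F 0 <-> cech1 F.
Proof.
split=> [H c01 c02 c12 F01 F02 F12 E|H c Hc dc].
  pose c t := if t == idx2 o0 o1 then c01 else if t == idx2 o0 o2 then c02 else c12.
  have ne12 : (idx2 o1 o2 == idx2 o0 o1) = false.
    by apply/eqP=> /ffunP/(_ ord0); rewrite !ffunE.
  have ne12' : (idx2 o1 o2 == idx2 o0 o2) = false.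
    by apply/eqP=> /ffunP/(_ ord0); rewrite !ffunE.
  have ne02 : (idx2 o0 o2 == idx2 o0 o1) = false.
    by apply/eqP=> /ffunP/(_ ord_max); rewrite !ffunE.
  have [||b Hb db] := H c.
  - move=> t /increasing2P[]->; rewrite im_idx2 /c ?eqxx ?ne12 ?ne12' ?ne02 //.
  - by move=> t /increasing3P->; rewrite coboundary1 /c !eqxx ne12 ne12' ne02.
  exists (fun i => b (idx1 i)); split.
  - by move=> i; have := Hb _ (increasing1 i); rewrite im_idx1.
  - by rewrite -coboundary0 -db ?/c ?eqxx //; apply: increasing2.
  - by rewrite -coboundary0 -db ?/c ?ne02 ?eqxx //; apply: increasing2.
  - by rewrite -coboundary0 -db ?/c ?ne12 ?ne12' //; apply: increasing2.
have inc := increasing2.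
have [|||| b [Hb E01 E02 E12]] := H (c (idx2 o0 o1)) (c (idx2 o0 o2)) (c (idx2 o1 o2)).
- by rewrite -im_idx2; apply: Hc; apply: inc.
- by rewrite -im_idx2; apply: Hc; apply: inc.
- by rewrite -im_idx2; apply: Hc; apply: inc.
- by rewrite -coboundary1 dc //; exact: increasing3.
exists (fun t => b (t ord0)).
  move=> t _; suff -> : [set t j | j : 'I_1] = [set t ord0] by [].
  by rewrite {1}(idx1E t) im_idx1.
by move=> t /increasing2P[]->; rewrite coboundary0 !ffunE.
Qed.

Lemma HS1P F : HS_vanishes F 1 <-> cech2 F.
Proof.
split=> [H c Fc|H c Hc _].
  have [||b Hb db] := H (fun=> c).
  - by move=> t /increasing3P->; rewrite im_idx3.
  - by move=> t /increasing_le.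
  have inc := increasing2.
  exists (b (idx2 o0 o1)), (b (idx2 o0 o2)), (b (idx2 o1 o2)); split.
  - by rewrite -im_idx2; apply: Hb; apply: inc.
  - by rewrite -im_idx2; apply: Hb; apply: inc.
  - by rewrite -im_idx2; apply: Hb; apply: inc.
  - by rewrite -coboundary1 -(db _ increasing3).
have [|c01 [c02 [c12 [F01 F02 F12 E]]]] := H (c idx3).
  by rewrite -im_idx3; apply: Hc; exact: increasing3.
pose b t := if t == idx2 o0 o1 then c01 else if t == idx2 o0 o2 then c02 else c12.
have ne12 : (idx2 o1 o2 == idx2 o0 o1) = false.
  by apply/eqP=> /ffunP/(_ ord0); rewrite !ffunE.
have ne12' : (idx2 o1 o2 == idx2 o0 o2) = false.
  by apply/eqP=> /ffunP/(_ ord0); rewrite !ffunE.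
have ne02 : (idx2 o0 o2 == idx2 o0 o1) = false.
  by apply/eqP=> /ffunP/(_ ord_max); rewrite !ffunE.
exists b.
  by move=> t /increasing2P[]->; rewrite im_idx2 /b ?eqxx ?ne12 ?ne12' ?ne02.
by move=> t /increasing3P->; rewrite coboundary1 /b !eqxx ne12 ne12' ne02.
Qed.

Lemma HS_high F q : (1 < q)%N -> (forall s, s != set0 -> F s 0) -> HS_vanishes F q.
Proof.
move=> q1 F0 c Hc dc; exists (fun=> 0); last by move=> t /increasing_le; lia.
by move=> t _; apply: F0; apply/set0Pn; exists (t ord0); apply: imset_f.
Qed.

Lemma cech1_ext F G : (forall s g, s != set0 -> F s g <-> G s g) -> cech1 F -> cech1 G.
Proof.
move=> FG H c01 c02 c12 G01 G02 G12 E.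
have n1 i : [set i] != set0 :> {set 'I_3} by apply/set0Pn; exists i; rewrite inE.
have n2 i j : [set i; j] != set0 :> {set 'I_3} by apply/set0Pn; exists i; rewrite !inE eqxx.
have [|||//|b [Hb ? ? ?]] := H c01 c02 c12; try by apply/FG.
by exists b; split=> // i; apply/FG.
Qed.

Lemma cech2_ext F G : (forall s g, s != set0 -> F s g <-> G s g) -> cech2 F -> cech2 G.
Proof.
move=> FG H c Gc.
have n2 i j : [set i; j] != set0 :> {set 'I_3} by apply/set0Pn; exists i; rewrite !inE eqxx.
have nT : setT != set0 :> {set 'I_3} by apply/set0Pn; exists o0; rewrite inE.
have [|c01 [c02 [c12 [H1 H2 H3 ->]]]] := H c; first by apply/FG.
by exists c01, c02, c12; split=> //; apply/FG.
Qed.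

Lemma Osec_cech2 n : -2 <= n -> cech2 (@Osec K n).
Proof.
move=> n2 c /(Osec_split n2)[h Hh ->].
have E l i j : (forall r : 'I_3, (r == i) || (r == j) = (r != l)) -> [set~ l] = [set i; j].
  by move=> H; apply/setP=> r; rewrite !inE H.
exists (h o2), (- h o1), (h o0); split.
- by rewrite -(E o2) //; apply: all3.
- by apply: Osec_opp; rewrite -(E o1) //; apply: all3.
- by rewrite -(E o0) //; apply: all3.
- by rewrite sum3 opprK.
Qed.

Lemma Osec_cech1 n : cech1 (@Osec K n).
Proof. by move=> c01 c02 c12; apply: Osec_H1. Qed.

Lemma cech2_vec n (e : 'I_3 -> Frac K) : -2 <= n -> (forall i, Osec n setT (e i)) ->
  exists e01 e02 e12 : 'I_3 -> Frac K, [/\ forall i, Osec n [set o0; o1] (e01 i),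
    forall i, Osec n [set o0; o2] (e02 i), forall i, Osec n [set o1; o2] (e12 i)
  & forall i, e i = e12 i - e02 i + e01 i].
Proof.
move=> n2 He; have /fin_all_exists[e01 /fin_all_exists[e02 /fin_all_exists[e12 H]]] :=
  fun i => Osec_cech2 n2 (He i).
by exists e01, e02, e12; split=> i; case: (H i).
Qed.

End Cech.

(** * Regularity, and its lower bound *)

Section Regularity.
Context {K : closedFieldType}.
Variables (d : nat) (f : Poly K).
Hypotheses (fh : f \is d.-homog) (f0 : f != 0) (d0 : d%:R != 0 :> K).
Hypothesis charK : [pchar K] =i pred0 \/ exists p, p \in [pchar K].
Hypothesis fred : is_reduced (curve_ideal d f).
Local Notation x := (@var K).
Local Notation gradf := (grad f).
Implicit Types (a : 'I_3 -> Frac K) (g h : Frac K) (s t : {set 'I_3}).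

Lemma is_regularP r : is_regular (curve_sing_ideal d f) r <->
  cech1 (comb gradf (r - d%:Z)) /\ cech2 (comb gradf (r - d%:Z - 1)).
Proof.
have E1 s g : s != set0 -> twist (curve_sing_ideal d f) (r - 1%:Z) s g
    <-> comb gradf (r - d%:Z) s g.
  move=> s0; rewrite twist_sing // (_ : _ + 1 = r - d%:Z) //; ring.
have E2 s g : s != set0 -> twist (curve_sing_ideal d f) (r - 2%:Z) s g
    <-> comb gradf (r - d%:Z - 1) s g.
  move=> s0; rewrite twist_sing // (_ : _ + 1 = r - d%:Z - 1) //; ring.
split=> [H|[H1 H2] [|[|q]]].
- split; first by apply: cech1_ext E1 _; apply/HS0P/(H 0%N).
  by apply: cech2_ext E2 _; apply/HS1P/(H 1%N).
- apply/HS0P; apply: cech1_ext H1 => s g s0; exact: iff_sym (E1 s g s0).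
- apply/HS1P; apply: cech2_ext H2 => s g s0; exact: iff_sym (E2 s g s0).
- by apply: HS_high => // s s0; exact: span0.
Qed.

Lemma comb_var a n s i g : comb a n s g -> comb a (n + 1) s (x i * g).
Proof. by rewrite addrC; apply: comb_scale; exact: Osec_var. Qed.

Lemma comb_varV a n s i g : i \in s -> comb a n s g -> comb a (n - 1) s (x i ^- 1 * g).
Proof. by move=> si; rewrite addrC; apply: comb_scale; exact: Osec_varV. Qed.

Lemma comb_mono a n s t g : s \subset t -> comb a n s g -> comb a n t g.
Proof. by move=> st [b Hb ->]; exists b => // i; apply: Osec_mono st _. Qed.

Lemma comb_opp a n s g : comb a n s g -> comb a n s (- g).
Proof.
by rewrite -mulN1r -[n in X in _ -> X]add0r; apply: comb_scale; apply/Osec_opp/Osec1.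
Qed.

Lemma comb_sub a n s g h : comb a n s g -> comb a n s h -> comb a n s (g - h).
Proof. by move=> Hg /comb_opp; apply: comb_add. Qed.

(** Castelnuovo-Mumford: r-regular implies (r+1)-regular. Writing a 1-cocycle
    as a combination of x_0 and x_1 is obstructed by an element of H^2, through
    the Koszul relation between x_0 and x_1. *)
Lemma comb_climb a (t : int) : cech1 (comb a t) -> cech2 (comb a (t - 1)) ->
  cech1 (comb a (t + 1)) /\ cech2 (comb a t).
Proof.
move=> H1 H2; split=> [c01 c02 c12 C01 C02 C12 E|c Hc]; last first.
  have [|c01 [c02 [c12 [C01 C02 C12 Ec]]]] := H2 (x o0 ^- 1 * c).
    by apply: comb_varV => //; rewrite inE.
  exists (x o0 * c01), (x o0 * c02), (x o0 * c12).
  split; try by rewrite -[t](subrK 1); apply: comb_var.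
  by rewrite -[c](@mulXVK _ _ (x o0) (var_neq0 o0)) Ec; ring.
have x0 := var_neq0 (K := K) o0; have x1 := var_neq0 (K := K) o1.
(* The lifts (c01 / x_0, 0), (c02 / x_0, 0) and (0, c12 / x_1) of the cocycle
   have coboundary (- x_1 w, x_0 w), with w = c12 / (x_0 x_1). *)
have [|w01 [w02 [w12 [W01 W02 W12 Ew]]]] :=
  H2 (x o1 ^- 1 * (x o0 ^- 1 * c12)).
  apply: comb_varV; rewrite ?inE //; rewrite -[t](addrK 1); apply: comb_varV; rewrite ?inE //.
  by apply: comb_mono C12; exact: subsetT.
have V n (s : {set 'I_3}) i g : i \in s -> comb a (n + 1) s g -> comb a n s (x i ^- 1 * g).
  by move=> si; rewrite -{2}[n](addrK 1); apply: comb_varV.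
have U n (s : {set 'I_3}) i g : comb a (n - 1) s g -> comb a n s (x i * g).
  by rewrite -{2}[n](subrK 1); apply: comb_var.
have [||||p [Hp P01 P02 P12]] := H1 (x o0 ^- 1 * c01 + x o1 * w01)
    (x o0 ^- 1 * c02 + x o1 * w02) (x o1 * w12).
- by apply: comb_add; [apply: V => //; rewrite !inE | apply: U].
- by apply: comb_add; [apply: V => //; rewrite !inE | apply: U].
- exact: U.
- exact: (@climbE1 (Frac K) c01 c02 c12 w01 w02 w12 (x o0) (x o1) x0 x1 E Ew).
have [||||q [Hq Q01 Q02 Q12]] := H1 (- (x o0 * w01)) (- (x o0 * w02))
    (x o1 ^- 1 * c12 - x o0 * w12).
- exact/comb_opp/U.
- exact/comb_opp/U.
- by apply: comb_sub; [apply: V => //; rewrite !inE | apply: U].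
- exact: (@climbE2 (Frac K) c12 w01 w02 w12 (x o0) (x o1) x0 x1 Ew).
(* p and q lift the cocycle along (x_0, x_1), now as cocycles. *)
exists (fun i => x o0 * p i + x o1 * q i); split.
- by move=> i; apply: comb_add; apply: comb_var.
- exact: (@climbE3 (Frac K) c01 (p o1) (p o0) (q o1) (q o0) w01 (x o0) (x o1) x0 P01 Q01).
- exact: (@climbE3 (Frac K) c02 (p o2) (p o0) (q o2) (q o0) w02 (x o0) (x o1) x0 P02 Q02).
- exact: (@climbE4 (Frac K) c12 (p o2) (p o1) (q o2) (q o1) w12 (x o0) (x o1) x1 P12 Q12).
Qed.

Lemma is_regular_le r r' : r <= r' -> is_regular (curve_sing_ideal d f) r ->
  is_regular (curve_sing_ideal d f) r'.
Proof.
move=> le; have [k ->] : exists k : nat, r' = r + k%:Z by exists `|r' - r|%N; lia.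
elim: k => [|k IH] H; first by rewrite addr0.
have /is_regularP[H1 H2] := IH H; have [C1 C2] := comb_climb H1 H2.
apply/is_regularP.
have E : r + k.+1%:Z - d%:Z = r + k%:Z - d%:Z + 1 by lia.
by rewrite E addrK.
Qed.

Lemma cross_sec n n' s (u v : 'I_3 -> Frac K) i : (forall i, Osec n s (u i)) ->
  (forall i, Osec n' s (v i)) -> Osec (n + n') s (cross u v i).
Proof.
by move=> su sv; move: i; apply: all3; rewrite /cross /=; apply: Osec_sub; apply: Osec_mul.
Qed.

Lemma grad_sec s i : Osec (d%:Z - 1) s (gradf i).
Proof.
have [E|d1] := posnP d; first by case/negP: d0; rewrite E.
apply: Osec_poly (mderiv_homog i fh) _; lia.
Qed.

Section VectorField.
Variables (M : nat) (A : 'I_3 -> Poly K).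
Hypotheses (Ah : forall i, A i \is M.-homog) (A0 : exists i, A i != 0).
Local Notation V := (fun i => frac_of (A i)).
Hypothesis Agrad : dot V gradf = 0.

Lemma V_sec s i : Osec M%:Z s (V i).
Proof. exact: Osec_poly (Ah i) _. Qed.

(** The determinant form of the bundle E of syzygies of the partial derivatives:
    E has rank 2 and determinant O(1 - d), so that pairing with V maps E(n) to
    O(n + M + 1 - d). *)
Lemma pairing n s e : s != set0 -> (forall i, Osec n s (e i)) -> dot e gradf = 0 ->
  exists2 h, Osec (n + M%:Z + 1 - d%:Z) s h & forall i, cross e V i = h * gradf i.
Proof.
move=> s0 se eg; have [h Eh] := cross_parallel eg Agrad (grad_neq0 fh f0 d0).
exists h => //; apply: (Osec_grad_cancel fh f0 d0 charK fred) => // i.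
rewrite -Eh (_ : _ + _ - 1 = n + M%:Z); last by ring.
by apply: cross_sec => // j; exact: V_sec.
Qed.

(** Pairing the syzygies c x grad f with V gives the scalar products c.V, which
    fill H^2(O(-3)). If H^1 of the ideal vanished, these syzygies would be
    coboundaries in E, and the classes c.V would be trivial. *)
Lemma not_cech1 : (M + 2 <= d)%N -> ~ cech1 (comb gradf (d%:Z - 4 - M%:Z)).
Proof.
move=> Md H; have [i0 Ai0] := A0; set t := d%:Z - 4 - M%:Z in H.
have [m mA] : exists m, m \in msupp (A i0).
  by move: Ai0; rewrite -msupp_eq0; case: (msupp (A i0)) => // m r _; exists m; rewrite mem_head.
have T0 : setT != set0 :> {set 'I_3} by apply/set0Pn; exists o0; rewrite inE.
(* c.V contains the monomial 1 / (x_0 x_1 x_2) with the coefficient of m. *)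
pose c i : Frac K := if i == i0 then (fmon (m + ind setT))^-1 else 0.
have sc i : Osec (- (M + 3)%N%:Z) setT (c i).
  rewrite /c; case: eqP => _; last exact: Osec0.
  have := @Osec_fmonV K setT (m + ind setT)%MM.
  rewrite mdegD (homog_mdeg (Ah i0) mA) mdeg_ind cardsT card_ord; apply.
  by move=> j; rewrite inE.
have cV : dot c V = frac_of (A i0) / fmon (m + ind setT).
  rewrite /dot (bigD1 i0) //= big1 ?addr0 => [|j /negbTE ji]; last by rewrite /c ji mul0r.
  by rewrite /c eqxx mulrC.
pose e := cross c gradf.
have se i : Osec t setT (e i).
  rewrite (_ : t = - (M + 3)%N%:Z + (d%:Z - 1)); last by rewrite /t; lia.
  by apply: cross_sec => // j; exact: grad_sec.
have eg : dot e gradf = 0 by exact: dot_cross.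
have t2 : -2 <= t by rewrite /t; lia.
have [b01 [b02 [b12 [B01 B02 B12 Eb]]]] := cech2_vec t2 se.
have [||||g [Hg G01 G02 G12]] := H (dot b01 gradf) (dot b02 gradf) (dot b12 gradf).
- by exists b01.
- by exists b02.
- by exists b12.
- rewrite -eg -dotBl -dotDl; apply: eq_bigr => i _; by rewrite Eb.
have /fin_all_exists[b Hb] : forall i, exists b : 'I_3 -> Frac K,
    (forall j, Osec t [set i] (b j)) /\ g i = dot b gradf.
  by move=> i; case: (Hg i) => b; exists b.
(* Correcting the vectors b_ij by the coboundary of b makes them syzygies,
   without changing their own coboundary e. *)
have step (i j : 'I_3) bij : (forall l, Osec t [set i; j] (bij l)) ->
    dot bij gradf = g j - g i -> exists2 h, Osec (-3) [set i; j] h &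
    forall l, cross (fun l => bij l - (b j l - b i l)) V l = h * gradf l.
  move=> sij Eij; have s0 : [set i; j] != set0 by apply/set0Pn; exists i; rewrite !inE eqxx.
  have [||h sh Eh] := @pairing t [set i; j] (fun l => bij l - (b j l - b i l)) s0.
  - move=> l; apply: Osec_sub => //; apply: Osec_sub.
      by apply: Osec_mono ((Hb j).1 l); rewrite sub1set !inE eqxx orbT.
    by apply: Osec_mono ((Hb i).1 l); rewrite sub1set !inE eqxx.
  - by rewrite !dotBl Eij -(Hb i).2 -(Hb j).2 subrr.
  by exists h => //; move: sh; rewrite (_ : t + _ + 1 - _ = -3) // /t; lia.
have [h01 S01 E01] := step _ _ _ B01 G01.
have [h02 S02 E02] := step _ _ _ B02 G02.
have [h12 S12 E12] := step _ _ _ B12 G12.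
pose h (l : 'I_3) := if l == o2 then h01 else if l == o1 then - h02 else h12.
have : frac_of (A i0) / fmon (m + ind setT) <> \sum_l h l.
  apply: Osec_nosplit => //; apply: all3; rewrite /h /=.
  - by rewrite (_ : [set~ o0] = [set o1; o2]) //; apply/setP; apply: all3; rewrite !inE.
  - rewrite (_ : [set~ o1] = [set o0; o2]); first exact: Osec_opp.
    by apply/setP; apply: all3; rewrite !inE.
  - by rewrite (_ : [set~ o2] = [set o0; o1]) //; apply/setP; apply: all3; rewrite !inE.
apply; rewrite -cV sum3 /h /=; have [l gl] := grad_neq0 fh f0 d0; apply: (mulIf gl).
have <- : cross e V l = dot c V * gradf l.
  rewrite cross_cross (_ : dot gradf V = 0) ?mulr0 ?subr0 // -Agrad /dot.
  by apply: eq_bigr => i _; rewrite mulrC.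
rewrite !mulrDl mulNr -E01 -E02 -E12 -crossBl -crossDl.
by apply: cross_ext => r; rewrite Eb; ring.
Qed.

End VectorField.

End Regularity.

(** * Functions on a finite subscheme *)

Section Finite.
Context {K : closedFieldType}.
Implicit Types (g h : Frac K) (s t : {set 'I_3}) (n : int).
Local Notation x := (@var K).

Definition ev (P : {poly K}) (u : Frac K) : Frac K := (map_poly cst P).[u].

Lemma evM P Q u : ev (P * Q) u = ev P u * ev Q u.
Proof. by rewrite /ev rmorphM hornerM. Qed.

Lemma evX u : ev 'X u = u.
Proof. by rewrite /ev map_polyX hornerX. Qed.

Lemma evXn e u : ev ('X^e) u = u ^+ e.
Proof. by rewrite /ev map_polyXn hornerXn. Qed.

Lemma evC c u : ev c%:P u = cst c.
Proof. by rewrite /ev map_polyC hornerC. Qed.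

Lemma evD P Q u : ev (P + Q) u = ev P u + ev Q u.
Proof. by rewrite /ev rmorphD hornerD. Qed.

Lemma ev_sec s P u : Osec 0 s u -> Osec 0 s (ev P u).
Proof.
move=> su; elim/poly_ind: P => [|P c IH].
  by rewrite -(rmorph0 (@polyC K)) evC; exact: Osec_cst.
rewrite evD evM evX evC; apply: Osec_add (Osec_cst _ _).
by rewrite -[0]addr0; apply: Osec_mul.
Qed.

(** The field K is algebraically closed. *)
Lemma ev_split P : P != 0 -> exists c (r : seq K), c != 0 /\
  forall u, ev P u = cst c * \prod_(z <- r) (u - cst z).
Proof.
move=> P0; have [r Er] := closed_field_poly_normal P.
exists (lead_coef P), r; split=> [|u]; first by rewrite lead_coef_eq0.
rewrite {1}Er -mul_polyC evM evC; congr (_ * _).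
elim: r {Er} => [|z r IH]; first by rewrite !big_nil evC rmorph1.
by rewrite !big_cons evM IH -polyCN evD evX evC rmorphN.
Qed.

(** If P(u) = 0 and u is invertible, then its inverse is a polynomial in u. *)
Lemma ev_unit_part P : P != 0 -> exists a (c : K) Q, c != 0 /\
  forall u, ev P u = u ^+ a * (cst c * (1 - u * ev Q u)).
Proof.
move=> P0; have [a [Q nr EP]] := multiplicity_XsubC P 0; rewrite P0 /= in nr.
have c0 : Q.[0] != 0 by [].
have [Q' EQ] : exists Q', Q - Q.[0]%:P = Q' * ('X - 0%:P).
  by apply/factor_theorem; rewrite /root !hornerE subrr.
move: EP EQ; rewrite subr0 => EP /(canRL (subrK _)) EQ.
exists a, Q.[0], ((- (Q.[0])^-1)%:P * Q'); split=> // u.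
rewrite EP {1}EQ !(evM, evD) evXn evX !evC rmorphN fmorphV.
have cc : cst Q.[0] != 0 by rewrite cst_eq0.
exact: (@unit_partE (Frac K) (u ^+ a) (ev Q' u) u (cst Q.[0]) cc).
Qed.

(** The space O(U_s) / I(U_s) has finite dimension, so the powers of u are
    linearly dependent in it. *)
Lemma finite_algebraic (I J : {set 'I_3} -> Frac K -> Prop) s u :
  s != set0 -> is_finite_subscheme I -> (forall g, I s g -> J s g) ->
  J s 0 -> (forall g h, J s g -> J s h -> J s (g + h)) ->
  (forall c g, J s g -> J s (cst c * g)) -> Osec 0 s u ->
  exists2 P, P != 0 & J s (ev P u).
Proof.
move=> s0 fin IJ J0 JD JZ su; have [n [b [sb Hb]]] := fin s s0.
have su_pow k : Osec 0 s (u ^+ k).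
  elim: k => [|k IH]; first exact: Osec1.
  by rewrite exprS -[0]addr0; apply: Osec_mul.
have /fin_all_exists[c Hc] : forall k : 'I_n.+1, exists c : 'I_n -> K,
    I s (u ^+ k - \sum_i cst (c i) * b i) by move=> k; apply: Hb.
pose C : 'M[K]_(n.+1, n) := \matrix_(k, i) c k i.
have kC : kermx C != 0.
  by rewrite -mxrank_eq0 mxrank_ker subn_eq0 -ltnNge ltnS rank_leq_col.
have /rowV0Pn[v /sub_kermxP vC v0] := kC.
exists (\poly_(k < n.+1) v ord0 (inord k)).
  apply: contra_neq v0 => /polyP z; apply/rowP=> k; rewrite mxE.
  by have := z k; rewrite coef_poly ltn_ord coef0 inord_val.
have -> : ev (\poly_(k < n.+1) v ord0 (inord k)) u = \sum_(k < n.+1) cst (v ord0 k) *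
    (u ^+ k - \sum_i cst (c k i) * b i).
  under [RHS]eq_bigr do rewrite mulrBr mulr_sumr.
  rewrite sumrB exchange_big [X in _ - X]big1 /= ?subr0 => [|i _]; last first.
    under eq_bigr do rewrite mulrA -rmorphM.
    rewrite -mulr_suml -rmorph_sum /=.
    have /rowP/(_ i) := vC; rewrite !mxE => Ei.
    suff -> : \sum_k v ord0 k * c k i = 0 by rewrite rmorph0 mul0r.
    by rewrite -[RHS]Ei; apply: eq_bigr => k _; rewrite mxE.
  rewrite /ev poly_def rmorph_sum /= horner_sum; apply: eq_bigr => k _.
  by rewrite inord_val -mul_polyC rmorphM /= map_polyC map_polyXn hornerM hornerC hornerXn.
by elim/big_rec: _ => // k y _ Hy; apply: JD => //; apply: JZ; apply: IJ.
Qed.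

End Finite.

(** * The upper bound on the regularity *)

Section FiniteVectorField.
Context {K : closedFieldType}.
Variables (d : nat) (f : Poly K).
Hypotheses (fh : f \is d.-homog) (f0 : f != 0) (d0 : d%:R != 0 :> K).
Hypothesis charK : [pchar K] =i pred0 \/ exists p, p \in [pchar K].
Hypothesis fred : is_reduced (curve_ideal d f).
Variables (M : nat) (A : 'I_3 -> Poly K).
Hypotheses (Ah : forall i, A i \is M.-homog) (A0 : exists i, A i != 0).
Local Notation V := (fun i => frac_of (A i)).
Local Notation gradf := (grad f).
Hypothesis Agrad : dot V gradf = 0.
Hypothesis Vfin : forall i j, exists2 P : {poly K}, P != 0 &
  comb V (- M%:Z) [set i] (ev P (var j / var i)).
Local Notation x := (@var K).
Implicit Types (a : 'I_3 -> Frac K) (g h : Frac K) (s : {set 'I_3}).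

Let set1n (i : 'I_3) : [set i] != set0. Proof. by apply/set0Pn; exists i; rewrite inE. Qed.
Let set2n (i j : 'I_3) : [set i; j] != set0.
Proof. by apply/set0Pn; exists i; rewrite !inE eqxx. Qed.
Let setTn : [set: 'I_3] != set0. Proof. by apply/set0Pn; exists o0; rewrite inE. Qed.
Let sub1l (i j : 'I_3) : [set i] \subset [set i; j]. Proof. by rewrite sub1set !inE eqxx. Qed.

Lemma comb_scale0 a n s c g : Osec 0 s c -> comb a n s g -> comb a n s (c * g).
Proof. by move=> sc; rewrite -[n in X in _ -> X]add0r; apply: comb_scale. Qed.

(** On the zeros of V in the intersection of U_i and U_j, the function 1 / x_j is
    the restriction of a section k over U_i: it is a polynomial in u = x_j / x_i,
    since u is invertible there and algebraic. *)
Lemma inverse_var (i j : 'I_3) : exists2 k, Osec (-1) [set i] k &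
  comb V (- M%:Z) [set i; j] (1 - x j * k).
Proof.
have [P P0 HP] := Vfin i j; have [e [c [Q [c0 EP]]]] := ev_unit_part P0.
have ii : i \in [set i] by rewrite inE.
pose u := x j / x i; have u0 : u != 0 by rewrite mulf_neq0 ?invr_neq0 ?var_neq0.
have su : Osec 0 [set i] u by exact: Osec_ratio.
exists (x i ^- 1 * ev Q u).
  by rewrite -[-1]addr0; apply: Osec_mul (ev_sec _ su); exact: Osec_varV.
have -> : 1 - x j * (x i ^- 1 * ev Q u) = 1 - u * ev Q u by rewrite mulrA.
have cc : cst c != 0 by rewrite cst_eq0.
rewrite -(@inverse_varE (Frac K) (u ^+ e) (cst c) (1 - u * ev Q u) cc (expf_neq0 _ u0)).
rewrite -EP; apply: comb_scale0.
  by rewrite -fmorphV; exact: Osec_cst.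
apply: comb_scale0; last by apply: comb_mono HP; exact: sub1l.
rewrite -exprVn /u invf_div; elim: e {EP} => [|e IH]; first exact: Osec1.
rewrite exprS -[0]addr0; apply: Osec_mul IH.
by apply: Osec_ratio; rewrite !inE eqxx orbT.
Qed.

Lemma inverse_varX (i j : 'I_3) (L : nat) : exists2 k, Osec (- L%:Z) [set i] k &
  comb V (- M%:Z) [set i; j] (1 - x j ^+ L * k).
Proof.
have [k sk Hk] := inverse_var i j; exists (k ^+ L).
  elim: L => [|L IH]; first by rewrite expr0; exact: Osec1.
  by rewrite exprS (_ : - L.+1%:Z = -1 + - L%:Z); [exact: Osec_mul | lia].
elim: L => [|L IH]; first by rewrite !expr0 mulr1 subrr; exact: comb0.
have -> : 1 - x j ^+ L.+1 * k ^+ L.+1 =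
    (1 - x j ^+ L * k ^+ L) + (x j * k) ^+ L * (1 - x j * k).
  by rewrite !exprS exprMn; ring.
apply: comb_add => //; apply: comb_scale0 => //.
have sxk : Osec 0 [set i; j] (x j * k).
  by rewrite -(addrN 1); apply: Osec_mul (Osec_var _ _) (Osec_mono (sub1l i j) sk).
elim: (L) => [|l IHl]; first exact: Osec1.
by rewrite exprS -[0]addr0; apply: Osec_mul.
Qed.

(** The zero scheme W of V, as a section of E(M), has for ideal the image of the
    pairing of V with syzygies. These have degree n here, so that h is a section of
    I_W(n + M + 1 - d). *)
Definition paired n s h := exists e : 'I_3 -> Frac K,
  [/\ forall i, Osec n s (e i), dot e gradf = 0 & forall i, cross e V i = h * gradf i].

Lemma paired_add n s g h : paired n s g -> paired n s h -> paired n s (g + h).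
Proof.
move=> [e [He eg Ee]] [e' [He' eg' Ee']]; exists (fun i => e i + e' i); split.
- by move=> i; apply: Osec_add.
- by rewrite dotDl eg eg' addr0.
- by move=> i; rewrite crossDl Ee Ee' mulrDl.
Qed.

Lemma paired_scale n n' s c h : Osec n' s c -> paired n s h -> paired (n' + n) s (c * h).
Proof.
move=> sc [e [He eg Ee]]; exists (fun i => c * e i); split.
- by move=> i; apply: Osec_mul.
- by rewrite dotZl eg mulr0.
- by move=> i; rewrite crossZl Ee mulrA.
Qed.

Lemma paired_opp n s h : paired n s h -> paired n s (- h).
Proof.
by rewrite -mulN1r -[n in X in _ -> X]add0r; apply: paired_scale; apply/Osec_opp/Osec1.
Qed.

Lemma paired_mono n s (t : {set 'I_3}) h : s \subset t -> paired n s h -> paired n t h.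
Proof. by move=> st [e [He eg Ee]]; exists e; split=> // i; apply: Osec_mono st _. Qed.

(** The components of V belong to the ideal of W, because of the Koszul syzygies
    c x grad f. *)
Lemma paired_comb n s h : comb V n s h -> paired (n + (d%:Z - 1)) s h.
Proof.
move=> [c Hc ->]; exists (cross c gradf); split.
- by move=> i; apply: cross_sec => // j; exact: grad_sec.
- exact: dot_cross.
- move=> i; rewrite cross_cross (_ : dot gradf V = 0) ?mulr0 ?subr0 //.
  by rewrite -Agrad /dot; apply: eq_bigr => j _; rewrite mulrC.
Qed.

(** Functions on W over the intersection of U_i and U_j extend to U_i. *)
Lemma extend_mod (i j : 'I_3) n y : i != j -> Osec n [set i; j] y ->
  exists2 z, Osec n [set i] z & comb V (n - M%:Z) [set i; j] (y - z).
Proof.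
move=> ij sy; have [L sL] := Osec_clear j sy; have [k sk Hk] := inverse_varX i j L.
exists (k * (x j ^+ L * y)).
  rewrite (_ : n = - L%:Z + (n + L%:Z)); last by ring.
  apply: Osec_mul => //; rewrite (_ : [set i] = [set i; j] :\ j) //.
  by apply/setP=> r; rewrite !inE; have [->|] := eqVneq r j; rewrite ?orbF //= eq_sym (negbTE ij).
by rewrite (_ : y - _ = y * (1 - x j ^+ L * k)); [exact: comb_scale | ring].
Qed.

Lemma clear_two n g : Osec n setT g -> exists N0, forall N, (N0 <= N)%N ->
  Osec (n + (N + N)%N%:Z) [set o2] (x o0 ^+ N * x o1 ^+ N * g).
Proof.
move=> sg; have [L0 H0] := Osec_clear o0 sg; have [L1 H1] := Osec_clear o1 H0.
have {}H1 : Osec (n + L0%:Z + L1%:Z) [set o2] (x o1 ^+ L1 * (x o0 ^+ L0 * g)).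
  by move: H1; rewrite (_ : _ :\ _ = [set o2]) //; apply/setP; apply: all3; rewrite !inE.
exists (L0 + L1)%N => N le.
have -> : x o0 ^+ N * x o1 ^+ N * g =
    (x o0 ^+ (N - L0) * x o1 ^+ (N - L1)) * (x o1 ^+ L1 * (x o0 ^+ L0 * g)).
  have p0 : x o0 ^+ N = x o0 ^+ (N - L0) * x o0 ^+ L0 by rewrite -exprD subnK //; lia.
  have p1 : x o1 ^+ N = x o1 ^+ (N - L1) * x o1 ^+ L1 by rewrite -exprD subnK //; lia.
  by rewrite p0 p1; ring.
rewrite (_ : n + _ = ((N - L0)%N%:Z + (N - L1)%N%:Z) + (n + L0%:Z + L1%:Z)); last by lia.
by apply: Osec_mul => //; apply: Osec_mul; exact: Osec_varX.
Qed.

(** H^2(I_W(-2)) = 0: write h as a coboundary in O(-2). As W is finite, the terms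
    can be changed modulo the components of V so that only a section w over U_2
    remains. Then w belongs to the ideal of W away from x_0 x_1 = 0, so that a
    multiple of w by powers of x_0 and x_1 belongs to it over U_2; and on W these
    powers are inverted by sections over U_2. *)
Lemma paired_cech2 h : let t := d%:Z - 3 - M%:Z in Osec (-2) setT h -> paired t setT h ->
  exists h01 h02 h12, [/\ paired t [set o0; o1] h01, paired t [set o0; o2] h02,
    paired t [set o1; o2] h12 & h = h12 - h02 + h01].
Proof.
move=> t sh ph; have [h01 [h02 [h12 [S01 S02 S12 Eh]]]] := Osec_cech2 (lexx (-2)) sh.
have pc s g : comb V (-2 - M%:Z) s g -> paired t s g.
  by move/paired_comb; rewrite (_ : _ + _ = t) // /t; ring.
have c20 : [set o2; o0] = [set o0; o2] by exact: setUC.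
have c21 : [set o2; o1] = [set o1; o2] by exact: setUC.
(* First h01 loses its poles along x_1 = 0 and joins h02; then h02 and h12 lose
   theirs along x_0 = 0 and x_1 = 0. *)
have [z0 Z0 C01] := extend_mod (isT : o0 != o1) S01.
have [z2 Z2 C02] : exists2 z, Osec (-2) [set o2] z &
    comb V (-2 - M%:Z) [set o0; o2] (h02 - z0 - z).
  rewrite -c20; apply: (extend_mod (isT : o2 != o0)); rewrite c20; apply: Osec_sub S02 _.
  by apply: Osec_mono Z0; exact: sub1l.
have [z2' Z2' C12] : exists2 z, Osec (-2) [set o2] z &
    comb V (-2 - M%:Z) [set o1; o2] (h12 - z).
  by rewrite -c21; apply: (extend_mod (isT : o2 != o1)); rewrite c21; exact: S12.
pose w := z2' - z2.
have sw : Osec (-2) [set o2] w by exact: Osec_sub.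
have pw : paired t setT w.
  have -> : w = h + (- (h01 - z0) + ((h02 - z0 - z2) - (h12 - z2'))) by rewrite /w Eh; ring.
  apply: paired_add => //; apply: paired_add.
    by apply/paired_opp/pc; apply: comb_mono C01; exact: subsetT.
  by apply: paired_add; [|apply: paired_opp]; apply: pc;
    [apply: comb_mono C02 | apply: comb_mono C12]; exact: subsetT.
have [N pN] : exists N, paired (t + (N + N)%N%:Z) [set o2] (x o0 ^+ N * x o1 ^+ N * w).
  have [e [He eg Ee]] := pw.
  have [N0 H0] := clear_two (He o0); have [N1 H1] := clear_two (He o1).
  have [N2 H2] := clear_two (He o2); exists (N0 + N1 + N2)%N.
  exists (fun i => x o0 ^+ (N0 + N1 + N2) * x o1 ^+ (N0 + N1 + N2) * e i); split.
  - by apply: all3; [apply: H0 | apply: H1 | apply: H2]; lia.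
  - by rewrite dotZl eg mulr0.
  - by move=> i; rewrite crossZl Ee mulrA.
have [k0 K0 E0] := inverse_varX o2 o0 N; have [k1 K1 E1] := inverse_varX o2 o1 N.
rewrite c20 in E0; rewrite c21 in E1.
have P2 : paired t [set o2] (k0 * k1 * (x o0 ^+ N * x o1 ^+ N * w)).
  rewrite (_ : t = (- N%:Z + - N%:Z) + (t + (N + N)%N%:Z)); last by lia.
  by apply: paired_scale => //; apply: Osec_mul.
have s2l : [set o2] \subset [set o0; o2] by rewrite sub1set !inE.
have s2r : [set o2] \subset [set o1; o2] by rewrite sub1set !inE.
(* With y_j = x_j^N k_j, split w as y_0 y_1 w + (1 - y_0) w + y_0 (1 - y_1) w. *)
exists (h01 - z0), ((h02 - z0 - z2) - k0 * k1 * (x o0 ^+ N * x o1 ^+ N * w)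
    - w * (1 - x o0 ^+ N * k0)),
  ((h12 - z2') + (x o0 ^+ N * k0) * w * (1 - x o1 ^+ N * k1)); split.
- exact: pc.
- do 2?apply: paired_add; [exact: pc | | ]; apply: paired_opp.
    exact: paired_mono P2.
  by apply: pc; apply: comb_scale E0; exact: Osec_mono sw.
- apply: paired_add; apply: pc; [exact: C12 | apply: comb_scale E1].
  rewrite -[-2]add0r; apply: Osec_mul (Osec_mono s2r sw).
  by rewrite -(addrN N%:Z); apply: Osec_mul (Osec_varX _ _ _) (Osec_mono s2r K0).
- by rewrite Eh /w; ring.
Qed.

(** The zeros of V being finite, its components have no common factor: their
    ideal contains products of linear forms in x_1, x_0 and in x_2, x_0. *)
Lemma V_cancel n q : (forall i, Osec (n + M%:Z) setT (q * V i)) -> Osec n setT q.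
Proof.
move=> H.
have Hj (j : 'I_3) : exists r : seq K,
    Osec n setT (q * \prod_(c <- r) (x j / x o0 - cst c)).
  have [P P0 [c Hc Ec]] := Vfin o0 j; have [c0 [r [cn0 Er]]] := ev_split P0.
  exists r; have E : q * \prod_(c <- r) (x j / x o0 - cst c) =
      cst c0^-1 * (\sum_i c i * (q * V i)).
    under [\sum_i _]eq_bigr do rewrite mulrCA.
    have cc : cst c0 != 0 by rewrite cst_eq0.
    rewrite -mulr_sumr -/(dot c V) -Ec Er fmorphV.
    exact: (@euler_inverseE (Frac K) (cst c0) q (\prod_(z <- r) (x j / x o0 - cst z)) cc).
  rewrite E -[n]add0r; apply: Osec_mul (Osec_cst _ _) _; apply: Osec_sum => // i _.
  rewrite (_ : n = - M%:Z + (n + M%:Z)); last by ring.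
  by apply: Osec_mul => //; apply: Osec_mono (Hc i); exact: subsetT.
have [r1 H1] := Hj o1; have [r2 H2] := Hj o2.
exact: (Osec_linprod (i := o1) (j := o2) (l := o0) _ _ _ H1 H2).
Qed.

(** A 1-cocycle of the ideal lifts to vectors whose coboundary e is a syzygy. Its
    pairing with V has degree -2, so it is a coboundary; hence so is e up to a
    multiple q V, where q has degree at least -1 and is a coboundary too. *)
Lemma finite_regular : (2 * M + 2 <= d)%N ->
  is_regular (curve_sing_ideal d f) (2 * d%:Z - 3 - M%:Z).
Proof.
move=> Md; apply/(is_regularP fh d0 _).
rewrite (_ : 2 * d%:Z - 3 - M%:Z - d%:Z = d%:Z - 3 - M%:Z); last by ring.
set t := d%:Z - 3 - M%:Z.
split=> [c01 c02 c12 [b01 B01 E01] [b02 B02 E02] [b12 B12 E12] E|c [b Hb ->]].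
  (* e is the coboundary of the lifts b_ij of the cocycle. *)
  pose e i := b12 i - b02 i + b01 i.
  have se i : Osec t setT (e i).
    apply: Osec_add; [apply: Osec_sub|];
      [exact: Osec_mono (B12 i)|exact: Osec_mono (B02 i)|exact: Osec_mono (B01 i)].
  have eg : dot e gradf = 0 by rewrite dotDl dotBl -E01 -E02 -E12.
  have [h sh Eh] := pairing fh f0 d0 charK fred Ah Agrad setTn se eg.
  have [||h01 [h02 [h12 [[e01 [S01 g01 P01]] [e02 [S02 g02 P02]] [e12 [S12 g12 P12]] Ehs]]]] :=
      @paired_cech2 h.
  - by move: sh; rewrite (_ : t + _ + 1 - _ = -2) // /t; ring.
  - by exists e; split.
  have [q Eq] : exists q, forall i, e i - (e12 i - e02 i + e01 i) = q * V i.
    apply: cross_eq0; last by have [i Ai] := A0; exists i; rewrite frac_of_neq0.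
    move=> i; rewrite (crossBl e (fun l => e12 l - e02 l + e01 l)).
    rewrite (crossDl (fun l => e12 l - e02 l) e01) (crossBl e12 e02).
    by rewrite Eh P01 P02 P12 Ehs; ring.
  have sq : Osec (t - M%:Z) setT q.
    apply: V_cancel => i; rewrite -Eq subrK; apply: Osec_sub => //.
    apply: Osec_add; [apply: Osec_sub|];
      [exact: Osec_mono (S12 i)|exact: Osec_mono (S02 i)|exact: Osec_mono (S01 i)].
  have [|q01 [q02 [q12 [Q01 Q02 Q12 Eqq]]]] := Osec_cech2 _ sq; first by rewrite /t; lia.
  have sV s g i : Osec (t - M%:Z) s g -> Osec t s (g * V i).
    by move=> sg; rewrite -[t](subrK M%:Z); apply: Osec_mul => //; exact: V_sec.
  have /fin_all_exists[y Hy] : forall l, exists y : 'I_3 -> Frac K,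
     [/\ forall i, Osec t [set i] (y i), b01 l - e01 l - q01 * V l = y o1 - y o0,
       b02 l - e02 l - q02 * V l = y o2 - y o0 & b12 l - e12 l - q12 * V l = y o2 - y o1].
    move=> l; apply: Osec_cech1.
    - by apply: Osec_sub (sV _ _ l Q01); apply: Osec_sub (B01 l) (S01 l).
    - by apply: Osec_sub (sV _ _ l Q02); apply: Osec_sub (B02 l) (S02 l).
    - by apply: Osec_sub (sV _ _ l Q12); apply: Osec_sub (B12 l) (S12 l).
    - have : e l - (e12 l - e02 l + e01 l) = (q12 - q02 + q01) * V l by rewrite Eq Eqq.
      move/eqP; rewrite -subr_eq0 => /eqP <-; rewrite /e; ring.
  (* Corrected by syzygies, the lifts form a cocycle of vectors. *)
  have descend (b e' z z' : 'I_3 -> Frac K) p : dot e' gradf = 0 ->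
      (forall l, b l - e' l - p * V l = z l - z' l) ->
      dot b gradf = dot z gradf - dot z' gradf.
    move=> H Hl; rewrite -dotBl.
    transitivity (dot (fun l => b l - e' l - p * V l) gradf).
      by rewrite !dotBl dotZl H Agrad mulr0 !subr0.
    by apply: eq_bigr => l _; rewrite Hl.
  exists (fun i => dot (fun l => y l i) gradf); split.
  - move=> i; exists (fun l => y l i); [move=> l; case: (Hy l) => H _ _ _; exact: H | by []].
  - rewrite E01.
    apply: (descend b01 e01 (fun l => y l o1) (fun l => y l o0) q01 g01) => l.
    by case: (Hy l).
  - rewrite E02.
    apply: (descend b02 e02 (fun l => y l o2) (fun l => y l o0) q02 g02) => l.
    by case: (Hy l).
  - rewrite E12.
    apply: (descend b12 e12 (fun l => y l o2) (fun l => y l o1) q12 g12) => l.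
    by case: (Hy l).
have [|e01 [e02 [e12 [S01 S02 S12 Eb]]]] := cech2_vec _ Hb; first by rewrite /t; lia.
exists (dot e01 gradf), (dot e02 gradf), (dot e12 gradf).
split; [by exists e01 | by exists e02 | by exists e12 |].
by rewrite -dotBl -dotDl; apply: eq_bigr => l _; rewrite Eb.
Qed.

End FiniteVectorField.

(** * Regularity of the singular scheme of a leaf *)

Lemma Omega_sec (K : fieldType) (s : {set 'I_3}) (w : Diff K) j :
  s != set0 -> Omega s w -> Osec (-1) s (w ord0 j).
Proof.
move=> s0; have [i si] := set0Pn _ s0.
apply: (span_ind (P := fun w : Diff K => Osec (-1) s (w ord0 j))).
- by rewrite mxE; exact: Osec0.
- by move=> v v' Hv Hv'; rewrite mxE; exact: Osec_add.
move=> a _ sa [g sg ->]; rewrite !mxE -[-1]add0r; apply: Osec_mul => //.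
have -> : partial j g = var i ^- 1 * (var i * partial j g) by rewrite mulKf ?var_neq0.
by rewrite -[-1]addr0; apply: Osec_mul (Osec_varV 1 si) (Osec_partial j si sg).
Qed.

(** eta is the scalar product with V, so S contains the zeros of V. *)
Lemma fol_sing_comb (K : closedFieldType) (m : int) (eta : Diff K -> Frac K)
    (V : 'I_3 -> Frac K) (s : {set 'I_3}) h : s != set0 ->
  (forall w, Omega s w -> eta w = dot V (fun j => w ord0 j)) ->
  fol_sing_ideal m eta s h -> comb V (- m) s h.
Proof.
move=> s0 etaV; apply: (span_ind (V := (Frac K)^o) (P := comb V (- m) s)).
- exact: comb0.
- by move=> v w; apply: comb_add.
move=> a _ sa [l [w [sl Ow ->]]]; rewrite /GRing.scale /= -[- m]add0r.
apply: comb_scale => //; exists (fun j => l * w ord0 j).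
  move=> j; rewrite (_ : - m = 1 - m + -1); last by ring.
  by apply: Osec_mul => //; exact: Omega_sec.
rewrite dotZl etaV //; congr (_ * _); by rewrite /dot; apply: eq_bigr => j _; rewrite mulrC.
Qed.

Theorem theorem2p5 (k : closedFieldType) (d : nat) (f : {mpoly k[3]})
  (m : int) (eta : Diff k -> Frac k) (sigma : int) :
  is_reduced_curve d f ->
  ([pchar k] =i pred0 \/ exists2 p : nat, p \in [pchar k] & ~~ (p %| d)%N) ->
  is_foliation m eta ->
  is_leaf m eta d f ->
  is_reg (curve_sing_ideal d f) sigma ->
  let rho := sigma - d%:Z + 2 in
  [/\ rho <= 0 -> d%:Z <= m + 1,
      0 < rho -> d%:Z <= m + 1 + rho
    & is_finite_subscheme (fol_sing_ideal m eta) -> 2 * m + 2 <= d%:Z ->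
      d%:Z = m + 1 + rho].
Proof.
move=> [[d_gt0 f0 fh] fred] hchar fol [_ _ leaf] [reg_sigma min_sigma] rho.
have charK : [pchar k] =i pred0 \/ exists p, p \in [pchar k].
  by case: hchar => [|[p pk _]]; [left | right; exists p].
have d0 : d%:R != 0 :> k.
  case: hchar => [/pcharf0P->|[p pk pd]]; first by rewrite -lt0n.
  by rewrite -(dvdn_pcharf pk).
have [A EA [M [mM Ah]]] := vf_poly fh f0 d0 fol leaf.
have A0 : exists i, A i != 0.
  have [i] := vf_neq0 fh f0 d0 fol; rewrite EA frac_of_neq0; by exists i.
have Agrad : dot (fun i => frac_of (A i)) (grad f) = 0.
  by rewrite -(vf_grad f0 d0 fol); apply: eq_bigr => i _; rewrite EA.
have lower : (M + 2 <= d)%N -> 2 * d%:Z - 3 - M%:Z <= sigma.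
  move=> Md; rewrite leNgt; apply/negP=> lt.
  have le : sigma <= 2 * d%:Z - 4 - M%:Z by lia.
  have /(is_regularP fh d0)[H _] := is_regular_le fh f0 d0 le reg_sigma.
  apply: (not_cech1 fh f0 d0 charK fred Ah A0 Agrad Md).
  by move: H; rewrite (_ : _ - d%:Z = d%:Z - 4 - M%:Z) //; ring.
have [Md|Md] := leqP (M + 2) d; last by rewrite mM; split=> *; lia.
have {}lower := lower Md.
split; [by rewrite /rho; lia | by rewrite /rho; lia | move=> fin dm].
suff /min_sigma upper : is_regular (curve_sing_ideal d f) (2 * d%:Z - 3 - M%:Z).
  by rewrite /rho; lia.
apply: (finite_regular fh f0 d0 charK fred Ah A0 Agrad); last by lia.
move=> i j; have s0 : [set i] != set0 by apply/set0Pn; exists i; rewrite inE.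
apply: (finite_algebraic s0 fin).
- move=> h; rewrite -mM; apply: fol_sing_comb => // w Ow.
  by rewrite (eta_vf fh f0 d0 fol s0 Ow); apply: eq_bigr => l _; rewrite EA.
- exact: comb0.
- by move=> g h; apply: comb_add.
- by move=> c g; apply: comb_scale0; exact: Osec_cst.
- by apply: Osec_ratio; rewrite inE.
Qed.
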